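(* For every integer $n>0$ there exists a measurable set $E\subset\mathbb{R}^n$ with $P(E)=\infty$ and such that $$\liminf_{\varepsilon\to 0}\frac{1}{|\log\varepsilon|}\,\|\gamma_\varepsilon*\mathbf{1}_E\|_{H^{1/2}}^2=0.$$
   Context: $P(E)$ is the perimeter of $E$ in $\mathbb{R}^n$ and $\mathbf{1}_E$ its indicator function. $\gamma$ is the standard Gaussian on $\mathbb{R}^n$ and $\gamma_\varepsilon(x)=\varepsilon^{-n}\gamma(x/\varepsilon)$. The (homogeneous) norm is $\|u\|_{H^{1/2}}^2=\int_{\mathbb{R}^n}|\xi|\,|\widehat u(\xi)|^2\,d\xi\in[0,\infty]$. Here $\widehat u$ is the Fourier transform (any fixed normalization), taken in the sense of tempered distributions; the integral is over $\mathbb{R}^n\setminus\{0\}$ and is interpreted as $+\infty$ if $\widehat u$ is not a locally square-integrable function on $\mathbb{R}^n\setminus\{0\}$. *)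

(* Defs.v *)
From HB Require Import structures.
From mathcomp Require Import all_boot all_order all_algebra.
From mathcomp Require Import all_classical all_reals all_analysis.
From mathcomp Require Import complex.

Set Implicit Arguments.
Unset Strict Implicit.
Unset Printing Implicit Defensive.

Import Order.TTheory GRing.Theory Num.Theory.
Import numFieldNormedType.Exports.

Local Open Scope classical_set_scope.
Local Open Scope ring_scope.

(* The sigma-algebra on row vectors generated by the coordinates (as the
   library does for [n.-tuple T]); for [T := R] these are the Borel sets. *)
Definition measure_rV_display : measure_display -> measure_display.
Proof. exact. Qed.

Section measurable_rV.
Context {d} {T : measurableType d}.
Variable n : nat.

Let coors : 'I_n -> 'rV[T]_n -> T := fun i x => x ord0 i.

Let rV_set0 : g_sigma_preimage coors set0.
Proof. exact: sigma_algebra0. Qed.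

Let rV_setC A : g_sigma_preimage coors A -> g_sigma_preimage coors (~` A).
Proof. exact: sigma_algebraC. Qed.

Let rV_bigcup (F : _^nat) : (forall i, g_sigma_preimage coors (F i)) ->
  g_sigma_preimage coors (\bigcup_i (F i)).
Proof. exact: sigma_algebra_bigcup. Qed.

HB.instance Definition _ := @isMeasurable.Build (measure_rV_display d)
  'rV[T]_n (g_sigma_preimage coors) rV_set0 rV_setC rV_bigcup.

End measurable_rV.

Section measurable_fun_rV.
Context d (T : measurableType d) d1 (T1 : measurableType d1) (n : nat).

Lemma measurable_rV_coord (i : 'I_n) :
  measurable_fun [set: 'rV[T]_n] (fun x : 'rV[T]_n => x ord0 i).
Proof.
move=> _ Y mY; rewrite setTI; apply: sub_sigma_algebra => /=.
rewrite -bigcup_seq/=; exists i => /=; first by rewrite mem_index_enum.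
by exists Y => //; rewrite setTI.
Qed.

Lemma measurable_fun_rV (f : T1 -> 'rV[T]_n) :
  (forall i, measurable_fun [set: T1] (fun x => f x ord0 i)) ->
  measurable_fun [set: T1] f.
Proof.
move=> mf; pose co (i : 'I_n) (x : 'rV[T]_n) := x ord0 i.
have fS : g_sigma_preimage (fun i => co i \o f) `<=` measurable.
  apply: smallest_sub; first exact: sigma_algebra_measurable.
  rewrite -bigcup_seq/=; apply: bigcup_sub => i Ii.
  by move=> A [B mB <-]; exact: mf.
have h := g_sigma_preimage_comp co f.
by move=> _ A mA; apply: fS; rewrite h; exists A.
Qed.

End measurable_fun_rV.

Section lebesgue_rV.
Context {R : realType}.

Definition cons_rV n (p : measurableTypeR R * 'rV[R]_n) : 'rV[R]_n.+1 :=
  \row_i (if unlift ord0 i is Some j then p.2 ord0 j else p.1).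

Definition uncons_rV n (v : 'rV[R]_n.+1) : measurableTypeR R * 'rV[R]_n :=
  (v ord0 ord0, \row_j v ord0 (lift ord0 j)).

Lemma cons_rVK n : cancel (@cons_rV n) (@uncons_rV n).
Proof.
case=> x v; rewrite /uncons_rV /cons_rV mxE unlift_none; congr pair.
by apply/rowP => j; rewrite !mxE liftK.
Qed.

Lemma measurable_cons_rV n : measurable_fun [set: measurableTypeR R * 'rV[R]_n] (@cons_rV n).
Proof.
apply: measurable_fun_rV => i.
case: (unliftP ord0 i) => [j|] ->.
- rewrite (_ : (fun _ => _) = fun x : measurableTypeR R * 'rV[R]_n => x.2 ord0 j).
    by apply: (measurableT_comp (@measurable_rV_coord _ _ n j)).
  by apply/funext => x; rewrite /cons_rV mxE liftK.
- rewrite (_ : (fun _ => _) = fst) //.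
  by apply/funext => x; rewrite /cons_rV mxE unlift_none.
Qed.

Lemma measurable_uncons_rV n :
  measurable_fun [set: 'rV[R]_n.+1] (@uncons_rV n).
Proof.
apply: measurable_fun_pair; first exact: measurable_rV_coord.
apply: measurable_fun_rV => i.
under eq_fun do rewrite mxE.
exact: measurable_rV_coord.
Qed.

Section step.
Variables (n : nat) (m : {sigma_finite_measure set 'rV[R]_n -> \bar R}).

Definition lebesgue_rV_step : set 'rV[R]_n.+1 -> \bar R :=
  pushforward (lebesgue_measure \x m)%E (@cons_rV n).

Let lebesgue_rV_step0 : lebesgue_rV_step set0 = 0%E.
Proof. by rewrite /lebesgue_rV_step /pushforward preimage_set0 measure0. Qed.

Let lebesgue_rV_step_ge0 A : (0 <= lebesgue_rV_step A)%E.
Proof. by rewrite /lebesgue_rV_step /pushforward; exact: measure_ge0. Qed.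

Let lebesgue_rV_step_sigma_additive : semi_sigma_additive lebesgue_rV_step.
Proof.
move=> F mF tF mUF; rewrite /lebesgue_rV_step /pushforward preimage_bigcup.
have mc A : measurable A -> measurable (@cons_rV n @^-1` A).
  by move=> mA; rewrite -[X in measurable X]setTI; exact: measurable_cons_rV.
apply: measure_semi_sigma_additive.
- by move=> k; exact: mc.
- apply/trivIsetP => /= i j _ _ ij; rewrite -preimage_setI.
  by move/trivIsetP : tF => /(_ _ _ _ _ ij) ->//; rewrite preimage_set0.
- by rewrite -preimage_bigcup; exact: mc.
Qed.

HB.instance Definition _ := isMeasure.Build _ _ _ lebesgue_rV_step
  lebesgue_rV_step0 lebesgue_rV_step_ge0 lebesgue_rV_step_sigma_additive.

Let lebesgue_rV_step_sigma_finite : sigma_finite setT lebesgue_rV_step.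
Proof.
have /sigma_finiteP[F [TF ndF mF]] := sigma_finiteT (@lebesgue_measure R).
have /sigma_finiteP[G [TG ndG mG]] := sigma_finiteT m.
exists (fun k => @uncons_rV n @^-1` (F k `*` G k)).
  apply/esym; rewrite -subTset => v _.
  have [i _ Fi] : (\bigcup_i F i) (uncons_rV v).1 by rewrite -TF.
  have [j _ Gj] : (\bigcup_i G i) (uncons_rV v).2 by rewrite -TG.
  exists (maxn i j) => //; split.
  - by move: Fi; exact/subsetPset/ndF/leq_maxl.
  - by move: Gj; exact/subsetPset/ndG/leq_maxr.
move=> k; have [mFk Fk] := mF k; have [mGk Gk] := mG k; split.
  by rewrite -[X in measurable X]setTI; apply: measurable_uncons_rV => //;
    exact: measurableX.
rewrite /lebesgue_rV_step /pushforward -comp_preimage.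
rewrite (_ : _ \o _ = id) ?preimage_id; last first.
  by apply/funext => x; exact: cons_rVK.
by rewrite product_measure1E// lte_mul_pinfty// ge0_fin_numE.
Qed.

HB.instance Definition _ := Measure_isSigmaFinite.Build _ _ _ lebesgue_rV_step
  lebesgue_rV_step_sigma_finite.

End step.

(* n-dimensional Lebesgue measure: the n-fold product of [lebesgue_measure],
   transported along R * R^n = R^(n+1). *)
Fixpoint lebesgue_rV (n : nat) : {sigma_finite_measure set 'rV[R]_n -> \bar R} :=
  match n with
  | 0 => dirac (0 : 'rV[R]_0)
  | k.+1 => lebesgue_rV_step (lebesgue_rV k)
  end.

Lemma lebesgue_rV_box (n : nat) (A : 'I_n -> set R) :
  (forall i, measurable (A i)) ->
  lebesgue_rV n [set x | forall i, A i (x ord0 i)] =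
  (\prod_(i < n) lebesgue_measure (A i))%E.
Proof.
elim: n A => [|n IHn] A mA.
  rewrite big_ord0 /= diracE mem_set//= => -[]//.
have mB : measurable [set x : 'rV[R]_n | forall i, A (lift ord0 i) (x ord0 i)].
  rewrite (_ : [set _ | _] = \bigcap_(i in [set: 'I_n])
      ((fun x : 'rV[R]_n => x ord0 i) @^-1` A (lift ord0 i))).
    apply: fin_bigcap_measurable => // i _.
    by rewrite -[X in measurable X]setTI; exact: measurable_rV_coord.
  by apply/seteqP; split => x /= h i; [move=> _|]; exact: h.
rewrite big_ord_recl -IHn//= -product_measure1E//; last exact: mA.
rewrite /lebesgue_rV_step /pushforward; congr (product_measure1 _ _ _).
apply/seteqP; split => -[x v] /=.
  move=> h; split=> [|i].
    by have := h ord0; rewrite mxE unlift_none.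
  by have := h (lift ord0 i); rewrite mxE liftK.
move=> [h0 h] i; rewrite mxE; case: unliftP => [j|] -> //=.
Qed.

End lebesgue_rV.

Section euclidean.
Context {R : realType} {n : nat}.
Implicit Types (x y : 'rV[R]_n) (E : set 'rV[R]_n).

Definition dot x y : R := \sum_(i < n) x ord0 i * y ord0 i.

(* Not the norm [`|x|] of the library on matrices, which is the sup norm. *)
Definition enorm x : R := Num.sqrt (dot x x).

Definition partial (i : 'I_n) (f : 'rV[R]_n -> R) : 'rV[R]_n -> R :=
  fun x => 'D_(delta_mx ord0 i) f x.

Fixpoint Ck (k : nat) (f : 'rV[R]_n -> R) : Prop :=
  continuous f /\
  match k with
  | 0 => True
  | k'.+1 => forall i : 'I_n,
      (forall x, derivable f x (delta_mx ord0 i)) /\ Ck k' (partial i f)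
  end.

Definition Cinfty (f : 'rV[R]_n -> R) : Prop := forall k, Ck k f.

Definition tsupport (V : nmodType) (f : 'rV[R]_n -> V) : set 'rV[R]_n :=
  closure [set x | f x != 0].

Definition divergence (phi : 'rV[R]_n -> 'rV[R]_n) : 'rV[R]_n -> R :=
  fun x => \sum_(i < n) partial i (fun y => phi y ord0 i) x.

Definition C1c_field (phi : 'rV[R]_n -> 'rV[R]_n) : Prop :=
  (forall i : 'I_n, Ck 1 (fun x => phi x ord0 i)) /\ compact (tsupport phi).

(* De Giorgi's perimeter in the whole space. *)
Definition perimeter E : \bar R :=
  ereal_sup [set (\int[lebesgue_rV n]_(x in E) (divergence phi x)%:E)%E
            | phi in [set phi | C1c_field phi /\ forall x, enorm (phi x) <= 1]].

Definition gauss x : R :=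
  Num.sqrt (2 * pi) ^- n * expR (- (dot x x / 2)).

Definition gauss_eps (eps : R) x : R := eps ^- n * gauss (eps^-1 *: x).

Definition convolution (f g : 'rV[R]_n -> R) : 'rV[R]_n -> R :=
  fun x => \int[lebesgue_rV n]_y (f (x - y) * g y).

End euclidean.

Section fourier.
Context {R : realType} {n : nat}.
Implicit Types (x xi : 'rV[R]_n) (Omega : set 'rV[R]_n).
Implicit Types (u g phi : 'rV[R]_n -> R[i]).

Definition cintegral (f : 'rV[R]_n -> R[i]) : R[i] :=
  Complex (\int[lebesgue_rV n]_x complex.Re (f x))
          (\int[lebesgue_rV n]_x complex.Im (f x)).

Definition cnorm2 (z : R[i]) : R := complex.Re z ^+ 2 + complex.Im z ^+ 2.

(* \int phi(x) exp(- i <x, xi>) dx *)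
Definition fourier phi : 'rV[R]_n -> R[i] :=
  fun xi => cintegral (fun x => phi x * Complex (cos (dot x xi)) (- sin (dot x xi))).

(* The Fourier transform of u as a tempered distribution, meaningful for u
   measurable and, e.g., bounded. *)
Definition fourier_distr u : ('rV[R]_n -> R[i]) -> R[i] :=
  fun phi => cintegral (fun x => u x * fourier phi x).

Definition test_function Omega phi : Prop :=
  [/\ Cinfty (fun x => complex.Re (phi x)),
      Cinfty (fun x => complex.Im (phi x)),
      compact (tsupport phi) & tsupport phi `<=` Omega].

Definition locally_L2 Omega g : Prop :=
  [/\ measurable_fun Omega (fun x => complex.Re (g x)),
      measurable_fun Omega (fun x => complex.Im (g x)) &
      forall K, compact K -> K `<=` Omega ->
        (\int[lebesgue_rV n]_(x in K) (cnorm2 (g x))%:E < +oo)%E].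

(* The distribution T is, on the open set Omega, the function g. *)
Definition distr_is_on Omega (T : ('rV[R]_n -> R[i]) -> R[i]) g : Prop :=
  forall phi, test_function Omega phi -> T phi = cintegral (fun x => g x * phi x).

(* The squared homogeneous norm. The g below is unique up to null sets, so the
   infimum is over at most one value, and it is +oo if there is no such g. *)
Definition Hhalf_norm2 u : \bar R :=
  let Omega := ~` [set 0 : 'rV[R]_n] in
  ereal_inf [set (\int[lebesgue_rV n]_(xi in Omega)
                    (enorm xi * cnorm2 (g xi))%:E)%E
            | g in [set g | locally_L2 Omega g /\
                            distr_is_on Omega (fourier_distr u) g]].

End fourier.

(* Main.v *)
Require Import Defs.
From HB Require Import structures.
From mathcomp Require Import all_boot all_order all_algebra.
From mathcomp Require Import all_classical all_reals all_analysis.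
From mathcomp Require Import measurable_realfun lebesgue_integral_under.
From mathcomp Require Import complex.
From mathcomp Require Import ring lra.

Set Implicit Arguments.
Unset Strict Implicit.
Unset Printing Implicit Defensive.

Import Order.TTheory GRing.Theory Num.Theory.
Import numFieldNormedType.Exports.

Local Open Scope classical_set_scope.
Local Open Scope ring_scope.

(* Baire category in the measure algebra. On open sets of finite measure, with
   the distance |E + S| of the symmetric difference, two families of properties
   are dense and stable under small perturbations, so that one set E has all of
   them.
   - Perimeter at least k: inside a thin box, replace E by the set where the
     divergence of a rapidly oscillating bump field is positive.
   - For some small eps, the integral of |xi| e^(- eps^2 |xi|^2) |FT 1_E|^2,
     which is the squared H^(1/2) norm of gamma_eps * 1_E, is at most
     |ln eps| / k. Take delta with gamma_delta * 1_E close to 1_E in L^1, and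
     replace E by a set S with |S & c| = int_c (gamma_delta * 1_E) in each cell c
     of a grid of mesh h. At bounded frequencies the transforms of 1_S and of
     gamma_delta * 1_E differ by O(h |xi|), so the energy of S at scale eps is
     O(1 + C_eps h^2) with O(1) depending on delta only: choose eps first, and
     then h. *)

(** * Gaussian integrals *)

(** At a fixed scale the two demands conflict, since the oscillation that creates perimeter also
    carries energy. They are compatible because the energy is tested at only one scale per step. A
    set dispersed over cells of size h much smaller than eps looks to the Gaussian of width eps like
    a density, here the smooth function gamma_delta * 1_E, whose energy stays bounded as eps tends
    to 0; its many small pieces are invisible at that scale. Later steps may spoil the energy at
    smaller scales, which a liminf tolerates. Both properties survive small changes in measure: the
    perimeter is a supremum of functionals int_E div phi, each continuous in measure, and at fixed
    eps the energy is continuous because the Gaussian cuts off high frequencies. Open sets are used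
    because gamma_delta * 1_E tends to 1 at every point of an open E by a plain tail estimate. The
    limit set is only measurable, so stability is asked against all measurable sets of finite
    measure. *)

Section real_integrable.
Context d (T : measurableType d) (R : realType) (mu : {measure set T -> \bar R}).
Variables (D : set T) (mD : measurable D).

Lemma integrable_EFinZl (k : R) (f : T -> R) : mu.-integrable D (EFin \o f) ->
  mu.-integrable D (EFin \o (fun x => k * f x)).
Proof.
move=> fi; rewrite (_ : _ \o _ = fun x => k%:E * (EFin \o f) x)%E.
  exact: integrableZl.
by apply/funext => x.
Qed.

Lemma integrable_EFinD (f g : T -> R) : mu.-integrable D (EFin \o f) ->
  mu.-integrable D (EFin \o g) ->
  mu.-integrable D (EFin \o (fun x => f x + g x)).
Proof. by move=> fi gi; exact: (integrableD mD fi gi). Qed.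

Lemma integrable_EFinB (f g : T -> R) : mu.-integrable D (EFin \o f) ->
  mu.-integrable D (EFin \o g) ->
  mu.-integrable D (EFin \o (fun x => f x - g x)).
Proof. by move=> fi gi; exact: (integrableB mD fi gi). Qed.

Lemma le_integrable_EFin (f g : T -> R) : measurable_fun D f ->
  (forall x, D x -> `|f x| <= g x) ->
  mu.-integrable D (EFin \o g) -> mu.-integrable D (EFin \o f).
Proof.
move=> mf fg; apply: le_integrable => //; first exact/measurable_EFinP.
by move=> x Dx /=; rewrite lee_fin (le_trans (fg x Dx))// ler_norm.
Qed.

End real_integrable.

Section line.
Context {R : realType}.
Notation leb := (@lebesgue_measure R).

(** The fundamental theorem of calculus on growing intervals, with dominated convergence under
    [|h'|]. It serves to integrate by parts against the Gaussian. *)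
Lemma Rintegral_derive_vanishing (h h' : R -> R) (a : R) :
  (forall x : R, is_derive x (1 : R) h (h' x)) -> continuous h' ->
  leb.-integrable setT (EFin \o h') ->
  h (a + n%:R) @[n --> \oo] --> 0 -> h (a - n%:R) @[n --> \oo] --> 0 ->
  \int[leb]_x h' x = 0.
Proof.
move=> dh ch ih hp hm.
(* [n.+1] keeps every interval nondegenerate, as the fundamental theorem of calculus requires. *)
pose I n : set R := `[a - n.+1%:R, a + n.+1%:R]%classic.
have mI n : measurable (I n) by exact: measurable_itv.
pose f (n : nat) : R -> \bar R := ((EFin \o h') \_ (I n)).
have mf n : measurable_fun setT (f n).
  apply/(measurable_restrictT _ _).1 => //.
  by apply: measurable_funTS; exact: (measurable_int _ ih).
have [] := @dominated_convergence _ _ _ leb setT measurableT f (EFin \o h')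
  (abse \o (EFin \o h')) mf.
- exact: (measurable_int _ ih).
- apply/aeW => x _; apply: cvg_near_cst.
  near=> n; rewrite /f patchE mem_set// /I /= in_itv/=.
  suff : `|x - a| <= n.+1%:R by rewrite ler_distl.
  suff : `|x - a| <= n%:R by move=> /le_trans; apply; rewrite ler_nat.
  by near: n; exact: nbhs_infty_ger.
- exact: integrable_abse.
- apply/aeW => x n _; rewrite /f patchE; case: ifP => // _.
  by rewrite (_ : point = 0%E) ?abse0//=.
move=> _ _ cv.
have e n : (\int[leb]_x f n x)%E = (h (a + n.+1%:R) - h (a - n.+1%:R))%:E.
  rewrite /f -integral_mkcond (@continuous_FTC2 _ _ h)//.
  - by rewrite -subr_gt0; have := ltr0Sn R n; lra.
  - exact: continuous_subspaceT.
  - have dd (x : R) : derivable h x 1 by have [] := dh x.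
    split => //.
    + apply: cvg_at_right_filter; apply: differentiable_continuous.
      exact/derivable1_diffP.
    + apply: cvg_at_left_filter; apply: differentiable_continuous.
      exact/derivable1_diffP.
  - by move=> x _; rewrite derive1E; have [] := dh x.
have : (h (a + n.+1%:R) - h (a - n.+1%:R))%:E @[n --> \oo] --> (0 - 0)%:E.
  apply: cvg_EFin; first exact: nearW.
  apply: cvgB.
    by rewrite (cvg_shiftS (fun n => h (a + n%:R))).
  by rewrite (cvg_shiftS (fun n => h (a - n%:R))).
rewrite subr0 /Rintegral; under eq_fun do rewrite -e.
by move=> /(cvg_unique _ cv) ->.
Unshelve. all: by end_near. Qed.

Lemma normal_pdf_exp (m s x : R) : 0 < s ->
  normal_pdf m s x = normal_peak s * expR (- ((s ^+ 2 *+ 2)^-1 * (x - m) ^+ 2)).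
Proof.
move=> s0; rewrite /normal_pdf gt_eqF// /normal_fun mulNr.
by rewrite [in LHS]mulrC [in LHS](mulrC (_ ^+ 2) _^-1) mulrC.
Qed.

Lemma is_derive_normal_pdf (m s x : R) : 0 < s ->
  is_derive x 1 (normal_pdf m s) (- (s ^- 2 * (x - m)) * normal_pdf m s x).
Proof.
move=> s0.
rewrite (_ : normal_pdf m s = fun x => normal_peak s *
    expR (- ((s ^+ 2 *+ 2)^-1 * (x - m) ^+ 2))); last first.
  by apply/funext => y; exact: normal_pdf_exp.
apply: is_derive_eq; rewrite /= !/GRing.scale /=.
by field; rewrite gt_eqF.
Qed.

(** With u = c q / 2 this is u e^(-u) <= 1: half of the exponent absorbs the factor [q]. All
    polynomial factors in front of Gaussians are removed this way. *)
Lemma mul_expRN_le (c q : R) : 0 < c -> 0 <= q ->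
  q * expR (- (c * q)) <= 2 / c * expR (- (c / 2 * q)).
Proof.
move=> c0 q0; pose u := c / 2 * q.
have u0 : 0 <= u by rewrite mulr_ge0// divr_ge0// ltW.
have -> : q = 2 / c * u by rewrite /u; field; rewrite gt_eqF.
have -> : c * (2 / c * u) = u + u by field; rewrite gt_eqF.
have -> : c / 2 * (2 / c * u) = u by field; rewrite gt_eqF.
rewrite -[leLHS]mulrA ler_pM2l ?divr_gt0// opprD expRD mulrA ler_piMl ?expR_ge0//.
rewrite expRN ler_pdivrMr ?expR_gt0// mul1r.
by apply: le_trans (expR_ge1Dx u); rewrite lerDr.
Qed.

(** |x - m| <= 1 + (x - m)^2, and half of the exponent absorbs the square; what is left is a
    multiple of the normal density of standard deviation sqrt 2 s. *)
Lemma integrable_normal_moment1 (m s : R) : 0 < s ->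
  leb.-integrable setT (EFin \o (fun x => `|x - m| * normal_pdf m s x)).
Proof.
move=> s0; pose t := Num.sqrt 2 * s.
have t0 : 0 < t by rewrite mulr_gt0// sqrtr_gt0.
pose c := (s ^+ 2 *+ 2)^-1.
have c0 : 0 < c by rewrite invr_gt0 pmulrn_lgt0// exprn_gt0.
pose K := normal_peak s * (1 + 2 / c) / normal_peak t.
apply: (@le_integrable _ _ _ leb setT measurableT _
   (EFin \o (fun x => K * normal_pdf m t x))).
- apply/measurable_EFinP/measurable_funM; last exact: measurable_normal_pdf.
  by apply: measurableT_comp => //; exact: measurable_funB.
- move=> x _; rewrite /= lee_fin.
  have p0 : 0 < normal_peak t by rewrite normal_peak_gt0// gt_eqF.
  have K0 : 0 <= K.
    apply: divr_ge0 (ltW p0); apply: mulr_ge0 (normal_peak_ge0 _) _.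
    by rewrite addr_ge0// divr_ge0// ltW.
  rewrite [leLHS]ger0_norm; last by rewrite mulr_ge0// normal_pdf_ge0.
  rewrite [leRHS]ger0_norm; last by rewrite mulr_ge0// normal_pdf_ge0.
  rewrite !normal_pdf_exp// -/c.
  have -> : (t ^+ 2 *+ 2)^-1 = c / 2.
    rewrite /t exprMn sqr_sqrtr// /c; field.
    by rewrite gt_eqF.
  rewrite /K.
  have -> : normal_peak s * (1 + 2 / c) / normal_peak t * (normal_peak t *
     expR (- (c / 2 * (x - m) ^+ 2))) =
     normal_peak s * ((1 + 2 / c) * expR (- (c / 2 * (x - m) ^+ 2))).
    by field; rewrite !gt_eqF.
  rewrite mulrCA ler_wpM2l ?normal_peak_ge0//.
  have h1 : `|x - m| <= 1 + (x - m) ^+ 2.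
    by rewrite -real_normK ?num_real//; nra.
  apply: le_trans (ler_wpM2r (expR_ge0 _) h1) _.
  rewrite mulrDl [leRHS]mulrDl !mul1r; apply: lerD.
    by rewrite ler_expR lerN2 ler_wpM2r ?sqr_ge0//; lra.
  by rewrite mul_expRN_le// sqr_ge0.
- by apply: integrable_EFinZl => //; exact: integrable_normal_pdf.
Qed.

Lemma integrable_normal_pdf_bounded (m s : R) (k : R -> R) : continuous k ->
  (forall x, `|k x| <= 1) ->
  leb.-integrable setT (EFin \o (fun x => normal_pdf m s x * k x)).
Proof.
move=> ck k1.
apply: (@le_integrable _ _ _ leb setT measurableT _
   (EFin \o (fun x => normal_pdf m s x))).
- apply/measurable_EFinP/measurable_funM; first exact: measurable_normal_pdf.
  exact: continuous_measurable_fun.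
- by move=> x _; rewrite /= lee_fin normrM ler_piMr.
- exact: integrable_normal_pdf.
Qed.

Lemma normal_pdf_cvg0 (m s : R) : 0 < s ->
  normal_pdf m s (m + n%:R) @[n --> \oo] --> 0 /\
  normal_pdf m s (m - n%:R) @[n --> \oo] --> 0.
Proof.
move=> s0; pose c := (s ^+ 2 *+ 2)^-1.
have c0 : 0 < c by rewrite invr_gt0 pmulrn_lgt0// exprn_gt0.
have h : (normal_peak s * expR (- c) ^+ n) @[n --> \oo] --> 0.
  rewrite -[X in _ --> X](mulr0 (normal_peak s)); apply: cvgMr.
  by apply: cvg_expr; rewrite ger0_norm ?expR_ge0// -expR0 ltr_expR oppr_lt0.
have b (n : nat) : expR (- (c * n%:R ^+ 2)) <= expR (- c) ^+ n.
  rewrite -expRM_natl ler_expR mulrN lerN2 [leLHS]mulrC.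
  rewrite ler_wpM2l ?(ltW c0)//.
  by rewrite -natrX ler_nat; case: n => // n; rewrite expnS leq_pmulr// expn_gt0.
split; apply: (@squeeze_cvgr _ _ _ _ (cst 0) _ _ _ _ _ h); try exact: cvg_cst.
- apply: nearW => n; rewrite normal_pdf_ge0/= normal_pdf_exp// ler_wpM2l//.
    exact: normal_peak_ge0.
  by rewrite addrAC subrr add0r b.
- apply: nearW => n; rewrite normal_pdf_ge0/= normal_pdf_exp// ler_wpM2l//.
    exact: normal_peak_ge0.
  by rewrite addrAC subrr add0r sqrrN b.
Qed.

Let sn (m t th x : R) := sin (t * (x - m) + th).
Let cs (m t th x : R) := cos (t * (x - m) + th).

Let continuous_sn m t th : continuous (sn m t th).
Proof.
move=> x; apply: continuous_comp; last exact: continuous_sin.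
apply: cvgD; last exact: cvg_cst.
by apply: cvgMr; apply: cvgB; [exact: cvg_id|exact: cvg_cst].
Qed.

Let continuous_cs m t th : continuous (cs m t th).
Proof.
move=> x; apply: continuous_comp; last exact: continuous_cos.
apply: cvgD; last exact: cvg_cst.
by apply: cvgMr; apply: cvgB; [exact: cvg_id|exact: cvg_cst].
Qed.

(** Integration by parts: the density p satisfies (x - m) p = - s^2 p', and p sin vanishes at
    infinity. *)
Let normal_moment_sn (m s t th : R) : 0 < s ->
  \int[leb]_x ((x - m) * normal_pdf m s x * sn m t th x) =
  s ^+ 2 * t * \int[leb]_x (normal_pdf m s x * cs m t th x).
Proof.
move=> s0; pose p := normal_pdf m s.
have ip : leb.-integrable setT (EFin \o (fun x => p x * cs m t th x)).
  apply: integrable_normal_pdf_bounded; first exact: continuous_cs.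
  by move=> x; rewrite ler_norml cos_geN1 cos_le1.
have iq : leb.-integrable setT (EFin \o (fun x => (x - m) * p x * sn m t th x)).
  apply: (@le_integrable _ _ _ leb setT measurableT _
   (EFin \o (fun x => `|x - m| * p x))).
  - apply/measurable_EFinP/measurable_funM.
      apply: measurable_funM; last exact: measurable_normal_pdf.
      exact: measurable_funB.
    by apply: continuous_measurable_fun; exact: continuous_sn.
  - move=> x _; rewrite /= lee_fin !normrM normr_id ler_piMr ?mulr_ge0//.
    by rewrite ler_norml sin_geN1 sin_le1.
  - exact: integrable_normal_moment1.
pose h' (x : R) := - (s ^- 2 * ((x - m) * p x * sn m t th x)) +
  t * (p x * cs m t th x).
have dh (x : R) : is_derive x (1 : R) (fun x => p x * sn m t th x) (h' x).
  have := is_derive_normal_pdf m x s0; rewrite -/p => ?.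
  have ? : is_derive x (1 : R) (sn m t th) (t * cs m t th x).
    rewrite /sn; apply: is_derive_eq; rewrite /GRing.scale/= /cs; ring.
  by apply: is_derive_eq; rewrite /h' /GRing.scale/=; ring.
have ch : continuous h'.
  have cp : continuous p by apply: continuous_normal_pdf; rewrite gt_eqF.
  move=> x; apply: cvgD.
    apply: cvgN; apply: cvgMr; apply: cvgM; last exact: continuous_sn.
    by apply: cvgM; [apply: cvgB; [exact: cvg_id|exact: cvg_cst]|exact: cp].
  by apply: cvgMr; apply: cvgM; [exact: cp|exact: continuous_cs].
have ih : leb.-integrable setT (EFin \o h').
  apply: integrable_EFinD => //; last exact: integrable_EFinZl.
  by under eq_fun do rewrite -mulNr; exact: integrable_EFinZl.
have [v1 v2] := normal_pdf_cvg0 m s0.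
have vb (u : nat -> R) : p (u n) @[n --> \oo] --> 0 ->
    (p (u n) * sn m t th (u n)) @[n --> \oo] --> 0.
  move=> pu; apply: norm_cvg0.
  apply: (squeeze_cvgr _ (cvg_cst 0) pu).
  apply: nearW => n; rewrite normr_ge0 normrM /= ger0_norm ?normal_pdf_ge0//.
  by rewrite ler_piMr ?normal_pdf_ge0// ler_norml sin_geN1 sin_le1.
have := Rintegral_derive_vanishing dh ch ih (vb _ v1) (vb _ v2).
under eq_Rintegral do rewrite /h' -mulNr.
rewrite RintegralD//; [|exact: integrable_EFinZl|exact: integrable_EFinZl].
rewrite RintegralZl// RintegralZl// mulNr => /eqP; rewrite addrC subr_eq0 => /eqP e.
by rewrite -mulrA e mulrA divff ?mul1r// gt_eqF ?exprn_gt0.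
Qed.

(** The differential equation F' = - s^2 t F of the characteristic function: differentiate under the
    integral, dominated by |x - m| p, then apply [normal_moment_sn]. *)
Let is_derive_normal_cos (m s th t : R) : 0 < s ->
  is_derive t (1 : R) (fun t => \int[leb]_x (normal_pdf m s x * cs m t th x))
    (- (s ^+ 2 * t) * \int[leb]_x (normal_pdf m s x * cs m t th x)).
Proof.
move=> s0; pose p := normal_pdf m s.
pose f (t x : R) := p x * cs m t th x.
have df (u x : R) : is_derive u (1 : R) (f ^~ x) (- ((x - m) * p x * sn m u th x)).
  by apply: is_derive_eq; rewrite /GRing.scale/= /sn; ring.
have d1 (u x : R) : (partial1of2 f) u x = - ((x - m) * p x * sn m u th x).
  by rewrite partial1of2E; have [] := df u x.
have It : `]t - 1, t + 1[%classic t by rewrite /= in_itv/=; apply/andP; split; lra.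
have If u : `]t - 1, t + 1[%classic u -> leb.-integrable setT (EFin \o f u).
  move=> _; apply: integrable_normal_pdf_bounded; first exact: continuous_cs.
  by move=> x; rewrite ler_norml cos_geN1 cos_le1.
have dF u x : `]t - 1, t + 1[%classic u -> setT x -> derivable (f ^~ x) u 1.
  by move=> _ _; have [] := df u x.
have G0 (x : R) : 0 <= `|x - m| * p x by rewrite mulr_ge0// normal_pdf_ge0.
have bG u x : `]t - 1, t + 1[%classic u -> setT x -> `|(partial1of2 f) u x| <= `|x - m| * p x.
  move=> _ _; rewrite d1 normrN 2!normrM (ger0_norm (normal_pdf_ge0 _ _ _)).
  by rewrite ler_piMr// ler_norml sin_geN1 sin_le1.
have mT : measurable [set: measurableTypeR R] by [].
have iG := integrable_normal_moment1 m s0.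
have H1 := derivable_under_integral mT It If dF G0 iG bG.
have H2 := differentiation_under_integral mT It If dF G0 iG bG.
split => //; rewrite -derive1E H2.
under eq_Rintegral do rewrite d1 -mulN1r.
rewrite RintegralZl//; last first.
  apply: le_integrable_EFin iG => //.
    apply: measurable_funM.
      apply: measurable_funM; last exact: measurable_normal_pdf.
      exact: measurable_funB.
    by apply: continuous_measurable_fun; exact: continuous_sn.
  move=> x _; rewrite 2!normrM (ger0_norm (normal_pdf_ge0 _ _ _)) ler_piMr//.
  by rewrite ler_norml sin_geN1 sin_le1.
by rewrite normal_moment_sn// mulN1r mulNr.
Qed.

(** The product of the integral with e^(s^2 u^2 / 2) has derivative zero in the frequency u, hence
    equals its value at u = 0. *)
Lemma Rintegral_normal_cos (m s t th : R) : 0 < s ->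
  \int[leb]_x (normal_pdf m s x * cos (t * x + th)) =
  expR (- (s ^+ 2 * t ^+ 2 / 2)) * cos (t * m + th).
Proof.
(* The phase [th'] is frozen at the final frequency [t]; in [F] only the frequency [u], which
   multiplies x - m, varies. *)
move=> s0; pose th' := t * m + th.
pose F (u : R) := \int[leb]_x (normal_pdf m s x * cs m u th' x).
pose E (u : R) := expR (s ^+ 2 * u ^+ 2 / 2).
have dE (u : R) : is_derive u (1 : R) E (s ^+ 2 * u * E u).
  by apply: is_derive_eq; rewrite /GRing.scale/= /E; field.
have dFE (u : R) : is_derive u (1 : R) (fun u => F u * E u) 0.
  have : is_derive u (1 : R) F (- (s ^+ 2 * u) * F u).
    exact: is_derive_normal_cos.
  move=> ?.
  by apply: is_derive_eq; rewrite /GRing.scale/=; ring.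
have := is_derive_0_is_cst t 0 dFE.
rewrite {2}/E expr0n/= mulr0 mul0r expR0 mulr1.
have -> : F 0 = cos th'.
  rewrite /F /cs; under eq_Rintegral do rewrite mul0r add0r mulrC.
  rewrite RintegralZl//; last exact: integrable_normal_pdf.
  by rewrite /Rintegral integral_normal_pdf/= mulr1.
move=> <-; rewrite /F /E expRN mulrC mulfK ?gt_eqF ?expR_gt0//.
by apply: eq_Rintegral => x _; congr (_ * cos _); rewrite /th'; ring.
Qed.

(* The summand 1 makes the integrand nonnegative, so that Tonelli's theorem
   extends the formula to several variables. *)
Lemma integral_normal_cos (m s t th b : R) : 0 < s -> `|b| <= 1 ->
  (\int[leb]_x (normal_pdf m s x * (1 + b * cos (t * x + th)))%:E =
  (1 + b * (expR (- (s ^+ 2 * t ^+ 2 / 2)) * cos (t * m + th)))%:E)%E.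
Proof.
move=> s0 b1.
have ic : leb.-integrable setT (EFin \o (fun x => normal_pdf m s x * cos (t * x + th))).
  apply: integrable_normal_pdf_bounded.
    move=> x; apply: continuous_comp; last exact: continuous_cos.
    by apply: cvgD; [apply: cvgMr; exact: cvg_id|exact: cvg_cst].
  by move=> x; rewrite ler_norml cos_geN1 cos_le1.
have ip := integrable_normal_pdf m s.
under eq_integral do rewrite mulrDr mulr1 mulrCA.
rewrite -(@fineK _ (\int[_]_x _)); last first.
  by apply: integrable_fin_num => //; apply: integrable_EFinD => //; exact: integrable_EFinZl.
congr EFin; have := @RintegralD _ _ _ leb _ _ _ measurableT ip (integrable_EFinZl measurableT b ic).
rewrite /Rintegral => ->; congr (_ + _); first by rewrite integral_normal_pdf.
by have := RintegralZl b measurableT ic; rewrite -Rintegral_normal_cos.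
Qed.

End line.

Lemma measurable_cos {R : realType} : measurable_fun [set: R] (@cos R).
Proof. by apply: continuous_measurable_fun; exact: continuous_cos. Qed.

Lemma cons_rV_head {R : realType} n (t : R) (v : 'rV[R]_n) :
  cons_rV (t, v) ord0 ord0 = t.
Proof. by rewrite mxE unlift_none. Qed.

Lemma cons_rV_tail {R : realType} n (t : R) (v : 'rV[R]_n) i :
  cons_rV (t, v) ord0 (lift ord0 i) = v ord0 i.
Proof. by rewrite mxE liftK. Qed.

Section rV_measurability.
Context {R : realType} {n : nat}.

Lemma measurable_rV_comp d (T : measurableType d) (f : T -> 'rV[R]_n) i :
  measurable_fun setT f -> measurable_fun setT (fun x => f x ord0 i).
Proof. by move=> mf; exact: (measurableT_comp (@measurable_rV_coord _ _ n i)). Qed.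

Lemma measurable_dot d (T : measurableType d) (f g : T -> 'rV[R]_n) :
  measurable_fun setT f -> measurable_fun setT g ->
  measurable_fun setT (fun x => dot (f x) (g x)).
Proof.
move=> mf mg; apply: measurable_sum => i.
by apply: measurable_funM; exact: measurable_rV_comp.
Qed.

Lemma measurable_subrV d (T : measurableType d) (f g : T -> 'rV[R]_n) :
  measurable_fun setT f -> measurable_fun setT g ->
  measurable_fun setT (fun x => f x - g x).
Proof.
move=> mf mg; apply: measurable_fun_rV => i; under eq_fun do rewrite !mxE.
by apply: measurable_funB; exact: measurable_rV_comp.
Qed.

Lemma measurable_prod_coord (f : 'I_n -> R -> R) :
  (forall i, measurable_fun setT (f i)) ->
  measurable_fun setT (fun x : 'rV[R]_n => \prod_i f i (x ord0 i)).
Proof.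
move=> mf; apply: measurable_prod => i _.
by apply: measurableT_comp; [exact: mf|exact: measurable_rV_coord].
Qed.

End rV_measurability.

(** * Iterated integrals over R^n *)

Section rV_integral.
Context {R : realType}.
Notation leb := (@lebesgue_measure R).

Lemma ge0_integral_rVS n (f : 'rV[R]_n.+1 -> \bar R) :
  measurable_fun setT f -> (forall x, 0 <= f x)%E ->
  (\int[lebesgue_rV n.+1]_x f x =
   \int[leb]_t \int[lebesgue_rV n]_v f (cons_rV (t, v)))%E.
Proof.
move=> mf f0; have mc := @measurable_cons_rV R n.
transitivity (\int[(leb \x lebesgue_rV n)%E]_p f (cons_rV p))%E.
  exact: (@ge0_integral_pushforward _ _ _ _ R _ mc
    (leb \x lebesgue_rV n)%E setT f measurableT mf (fun x _ => f0 x)).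
apply: (fubini_tonelli1 (m1 := leb) (m2 := lebesgue_rV n) (f \o @cons_rV R n)).
  exact: measurableT_comp.
by move=> p; exact: f0.
Qed.

Lemma ge0_integral_rV_prod n (f : 'I_n -> R -> R) :
  (forall i, measurable_fun setT (f i)) -> (forall i x, 0 <= f i x) ->
  (\int[lebesgue_rV n]_x (\prod_i f i (x ord0 i))%:E =
   \prod_i \int[leb]_t (f i t)%:E)%E.
Proof.
elim: n f => [|n ih] f mf f0.
  rewrite big_ord0 (_ : (fun _ => _) = cst 1%E); last first.
    by apply/funext => x; rewrite big_ord0.
  by rewrite integral_cst//= diracT mule1.
have p0 (v : 'rV[R]_n) : 0 <= \prod_i f (lift ord0 i) (v ord0 i).
  by apply: prodr_ge0 => i _.
rewrite ge0_integral_rVS; last 2 first.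
  by apply/measurable_EFinP; exact: measurable_prod_coord.
  by move=> x; rewrite lee_fin prodr_ge0.
rewrite big_ord_recl -ih// -ge0_integralZr//; last 3 first.
- by apply/measurable_EFinP; exact: mf.
- by move=> t _; rewrite lee_fin.
- by apply: integral_ge0 => v _; rewrite lee_fin.
apply: eq_integral => t _; rewrite -ge0_integralZl//; last 3 first.
- apply/measurable_EFinP.
  exact: (measurable_prod_coord (f := fun i => f (lift ord0 i))).
- by move=> v _; rewrite lee_fin.
- by rewrite lee_fin.
apply: eq_integral => v _; rewrite big_ord_recl cons_rV_head EFinM.
by congr (_ * _%:E)%E; apply: eq_bigr => i _; rewrite cons_rV_tail.
Qed.

(** The family of integrands is closed under integration in some of the variables: integrating out
    the tail multiplies the amplitude [b] by a damping factor at most 1 and shifts the phase [th].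
    This is why the induction is over all [b] and [th]. *)
Lemma integral_normal_cos_rV n (eps : R) (m xi : 'rV[R]_n) (b th : R) :
  0 < eps -> `|b| <= 1 ->
  (\int[lebesgue_rV n]_x
     (\prod_i normal_pdf (m ord0 i) eps (x ord0 i) *
      (1 + b * cos (dot x xi + th)))%:E =
   (1 + b * (expR (- (eps ^+ 2 * dot xi xi / 2)) * cos (dot m xi + th)))%:E)%E.
Proof.
move=> e0; elim: n m xi b th => [|n ih] m xi b th b1.
  rewrite (_ : (fun _ => _) = cst (1 + b * cos th)%:E); last first.
    by apply/funext => x; rewrite big_ord0 /dot big_ord0 mul1r add0r.
  rewrite integral_cst//= diracT mule1 /dot !big_ord0 mulr0 mul0r oppr0 expR0.
  by rewrite mul1r add0r.
have c0 (u v : R) : `|u| <= 1 -> 0 <= 1 + u * cos v.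
  move=> u1; suff : `|u * cos v| <= 1 by rewrite ler_norml; lra.
  by rewrite normrM mulr_ile1// ler_norml cos_geN1 cos_le1.
rewrite ge0_integral_rVS; last 2 first.
- apply/measurable_EFinP/measurable_funM.
    apply: (measurable_prod_coord (f := fun i => normal_pdf (m ord0 i) eps)).
    by move=> i; exact: measurable_normal_pdf.
  apply: measurable_funD => //; apply: measurable_funM => //.
  apply: measurableT_comp; first exact: measurable_cos.
  by apply: measurable_funD => //; exact: measurable_dot.
- by move=> x; rewrite lee_fin mulr_ge0 ?c0// prodr_ge0// => i _; exact: normal_pdf_ge0.
pose m' := (uncons_rV m).2; pose xi' := (uncons_rV xi).2.
pose t0 := xi ord0 ord0; pose m0 := m ord0 ord0.
have dE (v w : 'rV[R]_n.+1) : dot v w = v ord0 ord0 * w ord0 ord0 +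
    dot (uncons_rV v).2 (uncons_rV w).2.
  rewrite /dot big_ord_recl; congr +%R; apply: eq_bigr => i _.
  by rewrite !mxE.
pose E := expR (- (eps ^+ 2 * dot xi' xi' / 2)).
have E0 : 0 <= E by exact: expR_ge0.
have E1 : E <= 1.
  rewrite -expR0 ler_expR oppr_le0 divr_ge0// mulr_ge0 ?sqr_ge0//.
  by apply: sumr_ge0 => i _; rewrite -expr2 sqr_ge0.
transitivity (\int[leb]_t (normal_pdf m0 eps t *
    (1 + b * E * cos (t0 * t + (dot m' xi' + th))))%:E)%E; last first.
  rewrite integral_normal_cos//; last first.
    by rewrite normrM (ger0_norm E0) mulr_ile1.
  rewrite [dot xi xi]dE [dot m xi]dE -/m' -/xi' -/t0 -/m0.
  congr (_%:E); congr (1 + _).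
  rewrite (_ : - (eps ^+ 2 * (t0 * t0 + dot xi' xi') / 2) =
    - (eps ^+ 2 * dot xi' xi' / 2) - (eps ^+ 2 * t0 ^+ 2 / 2)); last by ring.
  rewrite expRD -/E -!mulrA; congr (_ * (_ * (_ * cos _))); ring.
apply: eq_integral => t _.
transitivity (\int[lebesgue_rV n]_v ((normal_pdf m0 eps t)%:E *
    (\prod_i normal_pdf (m' ord0 i) eps (v ord0 i) *
      (1 + b * cos (dot v xi' + (t0 * t + th))))%:E))%E.
  apply: eq_integral => v _; rewrite -EFinM big_ord_recl cons_rV_head -mulrA.
  congr (_ * (_ * _))%:E.
    by apply: eq_bigr => i _; rewrite cons_rV_tail /m' mxE.
  congr (1 + b * cos _); rewrite dE cons_rVK/= cons_rV_head -/t0 -/xi'; ring.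
rewrite ge0_integralZl//; last 3 first.
- apply/measurable_EFinP/measurable_funM.
    apply: (measurable_prod_coord (f := fun i => normal_pdf (m' ord0 i) eps)).
    by move=> i; exact: measurable_normal_pdf.
  apply: measurable_funD => //; apply: measurable_funM => //.
  apply: measurableT_comp; first exact: measurable_cos.
  by apply: measurable_funD => //; exact: measurable_dot.
- move=> v _; rewrite lee_fin mulr_ge0 ?c0// prodr_ge0// => i _.
  exact: normal_pdf_ge0.
- by rewrite lee_fin normal_pdf_ge0.
rewrite ih// -EFinM; congr (_ * (1 + _))%:E.
by rewrite -/E -!mulrA; congr (_ * (_ * cos _)); ring.
Qed.

End rV_integral.

Lemma measurable_set_lt d (T : measurableType d) (R : realType) (f : T -> R)
    (c : R) : measurable_fun setT f -> measurable [set x | f x < c].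
Proof.
move=> mf; rewrite (_ : [set _ | _] = setT `&` f @^-1` `]-oo, c[%classic).
  exact: mf.
by apply/seteqP; split => x /=; rewrite in_itv/= => //; case.
Qed.

(** * Open sets and the sigma-algebra of the coordinates *)

Section open_rV.
Context {R : realType} {n : nat}.

(** The topology comes from the sup norm and the sigma-algebra from the coordinates. They are linked
    by the countably many cubes of rational centre and radius 1/(k+1): an open set is the union of
    those that it contains. *)
Lemma open_rV_measurable (U : set 'rV[R]_n) : open U -> measurable U.
Proof.
move=> oU.
pose box (q : 'rV[rat]_n * nat) : set 'rV[R]_n :=
  [set x | forall i, `|x ord0 i - ratr (q.1 ord0 i)| < q.2.+1%:R^-1].
pose good (q : 'rV[rat]_n * nat) := if `[< box q `<=` U >] then box q else set0.
have mbox q : measurable (box q).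
  rewrite (_ : box q = \bigcap_(i in [set: 'I_n]) [set x : 'rV[R]_n |
      `|x ord0 i - ratr (q.1 ord0 i)| < q.2.+1%:R^-1]); last first.
    by apply/seteqP; split => x /= h i; [move=> _|]; exact: h.
  apply: fin_bigcap_measurable => // i _.
  apply: measurable_set_lt.
  apply: measurableT_comp => //; apply: measurable_funB => //.
  exact: measurable_rV_coord.
rewrite (_ : U = \bigcup_q good q).
  apply: countable_bigcupT_measurable => // q.
  by rewrite /good; case: ifP.
apply/seteqP; split => [x Ux|x [q _]]; last first.
  by rewrite /good; case: ifPn => // /asboolP; exact.
have /nbhs_ballP[e /= e0 xe] : nbhs x U by exact: open_nbhs_nbhs.
(* A radius below e / 2 suffices: x and any other point of the cube are both that close to its
   rational centre, hence at distance less than e. *)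
have [k ke] : exists k : nat, k.+1%:R^-1 < e / 2.
  have [k _ /(_ k (leqnn k))/= hk] := near_infty_natSinv_lt (PosNum (divr_gt0 e0 (@ltr0Sn R 1))).
  by exists k.
have k0 : (0 : R) < k.+1%:R^-1 by rewrite invr_gt0.
move eqc : (k.+1%:R^-1 : R) ke k0 => c ke k0.
have [q hq] : exists q : 'rV[rat]_n, forall i, `|x ord0 i - ratr (q ord0 i)| < c.
  have h i : exists r : rat, `|x ord0 i - ratr r| < c.
    have [|r] := @rat_in_itvoo R (x ord0 i - c) (x ord0 i + c); first lra.
    rewrite in_itv/= => /andP[r1 r2]; exists r.
    by rewrite ltr_norml; apply/andP; split; lra.
  have [f hf] := choice h.
  by exists (\row_i f i) => i; rewrite mxE.
suff bU : box (q, k) `<=` U by exists (q, k) => //; rewrite /good asboolT// => i; rewrite /= eqc.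
move=> y; rewrite /box /= eqc => hy.
apply: xe; rewrite mx_norm_ball /ball_/=.
rewrite [ltLHS](_ : _ = mx_norm (x - y))// mx_normrE.
apply/bigmax_ltP => /=; split => // -[i j] _ /=.
rewrite ord1 !mxE; have := hq j; have := hy j; rewrite !ltr_norml => /andP[a1 a2] /andP[b1 b2].
by apply/andP; split; lra.
Qed.

Lemma continuous_rV_measurable (f : 'rV[R]_n -> R) :
  continuous f -> measurable_fun setT f.
Proof.
move=> cf; apply: (measurability _ (RGenOpens.measurableE R)) => //.
move=> _ [_ [a [b ->] <-]]; rewrite setTI; apply: open_rV_measurable.
by move/continuousP : cf; apply; exact: interval_open.
Qed.

End open_rV.

(** * The Gaussian kernel on R^n *)

Section gauss_eps.
Context {R : realType} {n : nat}.
Implicit Types (x y v xi : 'rV[R]_n) (eps : R).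
Local Notation mu := (@lebesgue_rV R n).

Lemma dot_ge0 v : 0 <= dot v v.
Proof. by apply: sumr_ge0 => i _; rewrite -expr2 sqr_ge0. Qed.

Lemma dotC v x : dot v x = dot x v.
Proof. by apply: eq_bigr => i _; rewrite mulrC. Qed.

Lemma dot0r v : dot v 0 = 0.
Proof. by rewrite /dot big1// => i _; rewrite mxE mulr0. Qed.

Lemma dotZ (a : R) v : dot (a *: v) (a *: v) = a ^+ 2 * dot v v.
Proof.
by rewrite /dot mulr_sumr; apply: eq_bigr => i _; rewrite !mxE; ring.
Qed.

Lemma normal_peakE eps : 0 < eps ->
  normal_peak eps = eps^-1 * (Num.sqrt (2 * pi))^-1.
Proof.
move=> e0; rewrite /normal_peak -mulrnAr -mulr_natl sqrtrM ?sqr_ge0//.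
by rewrite sqrtr_sqr gtr0_norm// invfM.
Qed.

Lemma gauss_eps_exp eps v : 0 < eps ->
  gauss_eps eps v = normal_peak eps ^+ n * expR (- ((eps ^+ 2 *+ 2)^-1 * dot v v)).
Proof.
move=> e0; rewrite /gauss_eps /gauss normal_peakE// exprMn !exprVn -mulrA.
congr (_ * (_ * expR (- _))); rewrite dotZ; field.
by rewrite gt_eqF.
Qed.

Lemma gauss_eps_prod eps x y : 0 < eps ->
  gauss_eps eps (x - y) = \prod_i normal_pdf (y ord0 i) eps (x ord0 i).
Proof.
move=> e0; rewrite gauss_eps_exp// /dot mulr_sumr -sumrN expR_sum.
rewrite -[in X in X * _](card_ord n) -prodr_const -big_split/=.
by apply: eq_bigr => i _; rewrite normal_pdf_exp// !mxE -expr2.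
Qed.

Lemma gauss_eps_ge0 eps v : 0 < eps -> 0 <= gauss_eps eps v.
Proof.
by move=> e0; rewrite gauss_eps_exp// mulr_ge0 ?expR_ge0// exprn_ge0// normal_peak_ge0.
Qed.

Lemma gauss_eps_sym eps x y : 0 < eps -> gauss_eps eps (x - y) = gauss_eps eps (y - x).
Proof.
move=> e0; rewrite !gauss_eps_exp//; congr (_ * expR (- (_ * _))).
by apply: eq_bigr => i _; rewrite !mxE; ring.
Qed.

Lemma measurable_gauss_eps d (T : measurableType d) eps (f : T -> 'rV[R]_n) :
  0 < eps -> measurable_fun setT f ->
  measurable_fun setT (fun t => gauss_eps eps (f t)).
Proof.
move=> e0 mf; under eq_fun do rewrite gauss_eps_exp//.
apply: measurable_funM => //; apply: measurableT_comp => //.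
apply: measurableT_comp => //; apply: measurable_funM => //.
exact: measurable_dot.
Qed.

Lemma integral_gauss_eps_cos eps y xi b th : 0 < eps -> `|b| <= 1 ->
  (\int[mu]_x (gauss_eps eps (x - y) * (1 + b * cos (dot x xi + th)))%:E =
   (1 + b * (expR (- (eps ^+ 2 * dot xi xi / 2)) * cos (dot y xi + th)))%:E)%E.
Proof.
move=> e0 b1; rewrite -integral_normal_cos_rV//.
by apply: eq_integral => x _; rewrite gauss_eps_prod.
Qed.

Lemma integral_gauss_epsl eps y : 0 < eps ->
  (\int[mu]_x (gauss_eps eps (x - y))%:E = 1)%E.
Proof.
move=> e0; have := @integral_gauss_eps_cos eps y 0 0 0 e0; rewrite normr0 => /(_ ler01).
rewrite mul0r addr0 => <-; apply: eq_integral => x _.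
by rewrite mul0r addr0 mulr1.
Qed.

Lemma integral_gauss_epsr eps x : 0 < eps ->
  (\int[mu]_y (gauss_eps eps (x - y))%:E = 1)%E.
Proof.
move=> e0; rewrite -(integral_gauss_epsl x e0); apply: eq_integral => y _.
by rewrite gauss_eps_sym.
Qed.

Lemma integrable_expRN_dot (a : R) : 0 < a ->
  mu.-integrable setT (EFin \o (fun v => expR (- (a * dot v v)))).
Proof.
move=> a0; pose s := Num.sqrt (a *+ 2)^-1.
have s0 : 0 < s by rewrite sqrtr_gt0 invr_gt0 pmulrn_lgt0.
have sa : (s ^+ 2 *+ 2)^-1 = a.
  rewrite sqr_sqrtr ?invr_ge0 ?pmulrn_lge0 ?ltW//.
  by field; rewrite gt_eqF.
have p0 : 0 < normal_peak s ^+ n by rewrite exprn_gt0// normal_peak_gt0// gt_eqF.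
rewrite (_ : (fun v => _) = fun v => (normal_peak s ^+ n)^-1 * gauss_eps s v); last first.
  by apply/funext => v; rewrite gauss_eps_exp// sa mulKf// gt_eqF.
apply: integrable_EFinZl => //; apply/integrableP; split.
  by apply/measurable_EFinP; exact: measurable_gauss_eps.
under eq_integral do rewrite /= ger0_norm ?gauss_eps_ge0//.
rewrite (_ : (\int[mu]_x _)%E = 1%E) ?ltry//.
by rewrite -(integral_gauss_epsl 0 s0); apply: eq_integral => x _; rewrite subr0.
Qed.

(** Half of the exponent absorbs |v|^2 at the cost 2 / c = 4 eps^2. The other half is that of the
    Gaussian of width sqrt 2 eps, whose peak is lower by the factor sqrt 2 ^ n. Integrated, this
    bounds the second moment, for a Chebyshev estimate of the tails. *)
Lemma gauss_eps_second_moment eps v : 0 < eps ->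
  dot v v * gauss_eps eps v <=
  4 * Num.sqrt 2 ^+ n * eps ^+ 2 * gauss_eps (Num.sqrt 2 * eps) v.
Proof.
move=> e0; have r0 : 0 < Num.sqrt 2 :> R by rewrite sqrtr_gt0.
have t0 : 0 < Num.sqrt 2 * eps by rewrite mulr_gt0.
pose c := (eps ^+ 2 *+ 2)^-1.
have c0 : 0 < c by rewrite invr_gt0 pmulrn_lgt0// exprn_gt0.
rewrite !gauss_eps_exp// -/c.
have -> : ((Num.sqrt 2 * eps) ^+ 2 *+ 2)^-1 = c / 2.
  by rewrite exprMn sqr_sqrtr// /c; field; rewrite gt_eqF.
have -> : normal_peak (Num.sqrt 2 * eps) = (Num.sqrt 2)^-1 * normal_peak eps.
  by rewrite !normal_peakE// invfM -mulrA.
rewrite exprMn mulrCA.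
have -> : forall e, 4 * Num.sqrt 2 ^+ n * eps ^+ 2 *
    ((Num.sqrt 2)^-1 ^+ n * normal_peak eps ^+ n * e) =
    normal_peak eps ^+ n * (2 / c * e).
  move=> e; rewrite exprVn /c; field.
  by rewrite expf_eq0 (gt_eqF r0) andbF gt_eqF.
by rewrite ler_wpM2l ?mul_expRN_le ?dot_ge0// exprn_ge0// normal_peak_ge0.
Qed.

Lemma integrable_poly_expRN_dot (a : R) : 0 < a ->
  mu.-integrable setT
    (EFin \o (fun v => (1 + dot v v) ^+ 2 * expR (- (a * dot v v)))).
Proof.
(* The three summands correspond to 1, 2 q and q^2 in (1 + q)^2, absorbed by zero, one and two
   halvings of the exponent; all are then compared at the exponent a / 4. *)
move=> a0; pose C := 1 + 2 * (2 / a) + 2 / a * (2 / (a / 2)).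
have a40 : 0 < a / 4 by rewrite divr_gt0.
have iC := integrable_EFinZl measurableT C (integrable_expRN_dot a40).
apply: le_integrable_EFin iC => //.
  apply: measurable_funM.
    by apply: measurable_funX; apply: measurable_funD => //; exact: measurable_dot.
  apply: measurableT_comp => //; apply: measurableT_comp => //.
  by apply: measurable_funM => //; exact: measurable_dot.
move=> v _; set q := dot v v; have q0 : 0 <= q by exact: dot_ge0.
rewrite ger0_norm ?(mulr_ge0 (sqr_ge0 _) (expR_ge0 _))//.
have h1 : q * expR (- (a * q)) <= 2 / a * expR (- (a / 2 * q)) by exact: mul_expRN_le.
have h2 : q * expR (- (a / 2 * q)) <= 2 / (a / 2) * expR (- (a / 2 / 2 * q)).
  by apply: mul_expRN_le => //; rewrite divr_gt0.
have h3 : expR (- (a * q)) <= expR (- (a / 4 * q)).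
  by rewrite ler_expR lerN2 ler_wpM2r//; lra.
have h4 : expR (- (a / 2 * q)) <= expR (- (a / 4 * q)).
  by rewrite ler_expR lerN2 ler_wpM2r//; lra.
have h5 : a / 2 / 2 = a / 4 by field.
rewrite h5 in h2.
have -> : (1 + q) ^+ 2 * expR (- (a * q)) =
  expR (- (a * q)) + 2 * (q * expR (- (a * q))) + q * (q * expR (- (a * q))) by ring.
rewrite (_ : C * _ = expR (- (a / 4 * q)) + 2 * (2 / a * expR (- (a / 4 * q))) +
  2 / a * (2 / (a / 2) * expR (- (a / 4 * q)))); last by rewrite /C; ring.
have A0 : 0 <= 2 / a by rewrite divr_ge0// ltW.
apply: lerD; first (apply: lerD => //).
  by rewrite ler_wpM2l//; apply: le_trans h1 _; rewrite ler_wpM2l.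
apply: (@le_trans _ _ (q * (2 / a * expR (- (a / 2 * q))))).
  by rewrite ler_wpM2l.
by rewrite mulrCA ler_wpM2l.
Qed.

End gauss_eps.

(** * The Fourier transform of a smoothed set *)

Section smoothing.
Context {R : realType} {n : nat}.
Implicit Types (x y xi : 'rV[R]_n) (eps th : R) (E : set 'rV[R]_n).
Local Notation mu := (@lebesgue_rV R n).

(* The phases th = 0 and th = - pi / 2 give the real part and minus the imaginary
   part of the Fourier transform of \1_E. *)
Definition trig E th xi : R := \int[mu]_(x in E) cos (dot x xi + th).

Lemma measurable_cos_dot d (T : measurableType d) (f g : T -> 'rV[R]_n) th :
  measurable_fun setT f -> measurable_fun setT g ->
  measurable_fun setT (fun t => cos (dot (f t) (g t) + th)).
Proof.
move=> mf mg; apply: measurableT_comp; first exact: measurable_cos.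
by apply: measurable_funD => //; exact: measurable_dot.
Qed.

Lemma measurable_indic_snd E : measurable E ->
  measurable_fun setT (fun p : 'rV[R]_n * 'rV[R]_n => \1_E p.2 : R).
Proof.
move=> mE; have mi : measurable_fun setT (\1_E : 'rV[R]_n -> R).
  exact: measurable_indic.
exact: (measurableT_comp mi measurable_snd).
Qed.

Lemma norm_cos_le1 (z : R) : `|cos z| <= 1.
Proof. by rewrite ler_norml cos_geN1 cos_le1. Qed.

Lemma cos_add1_ge0 (z : R) : 0 <= 1 + cos z.
Proof. by have := cos_geN1 z; lra. Qed.

Lemma finite_measure_fineK E : (mu E < +oo)%E -> ((fine (mu E))%:E = mu E)%E.
Proof. by move=> Ey; rewrite fineK// ge0_fin_numE. Qed.

Lemma integrable_bounded_on E (f : 'rV[R]_n -> R) (M : R) : measurable E ->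
  (mu E < +oo)%E -> measurable_fun setT f -> (forall x, `|f x| <= M) ->
  mu.-integrable E (EFin \o f).
Proof.
move=> mE Ey mf fM; apply: measurable_bounded_integrable => //.
  exact: measurable_funTS.
exists M; split; first exact: num_real.
by move=> z Mz x _ /=; rewrite (le_trans (fM x))// ltW.
Qed.

Lemma Rintegral_bounded_on E (f : 'rV[R]_n -> R) (M : R) : measurable E ->
  (mu E < +oo)%E -> measurable_fun setT f -> (forall x, `|f x| <= M) ->
  `|\int[mu]_(x in E) f x| <= M * fine (mu E).
Proof.
move=> mE Ey mf fM; have fi := integrable_bounded_on mE Ey mf fM.
apply: le_trans (le_normr_Rintegral mE fi) _.
rewrite -Rintegral_cst//; apply: le_Rintegral => //.
  exact: integrable_norm.
apply: (@integrable_bounded_on _ _ `|M|) => //.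
Qed.

Lemma trig_bound E th xi : measurable E -> (mu E < +oo)%E ->
  `|trig E th xi| <= fine (mu E).
Proof.
move=> mE Ey; rewrite -[leRHS]mul1r; apply: Rintegral_bounded_on => //.
  exact: measurable_cos_dot.
by move=> x; exact: norm_cos_le1.
Qed.

(** The passage between the signed integral [trig] and nonnegative integrands, to which Tonelli's
    theorem applies. *)
Lemma trig_tonelli E th xi (b : R) : measurable E -> (mu E < +oo)%E -> `|b| <= 1 ->
  (\int[mu]_(x in E) (1 + b * cos (dot x xi + th))%:E =
   (fine (mu E) + b * trig E th xi)%:E)%E.
Proof.
move=> mE Ey b1.
have ic : mu.-integrable E (EFin \o (fun x => cos (dot x xi + th))).
  apply: (@integrable_bounded_on _ _ 1) => //; first exact: measurable_cos_dot.
  by move=> x; exact: norm_cos_le1.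
have i1 : mu.-integrable E (EFin \o (fun=> 1)).
  by apply: (@integrable_bounded_on _ _ 1) => // x; rewrite normr1.
have ibc := integrable_EFinZl mE b ic.
rewrite -[LHS]fineK; last by apply: integrable_fin_num => //; exact: integrable_EFinD.
rewrite [fine _](RintegralD mE i1 ibc).
by rewrite Rintegral_cst// mul1r RintegralZl.
Qed.

Lemma measurable_trig E th : measurable E -> (mu E < +oo)%E ->
  measurable_fun setT (trig E th).
Proof.
move=> mE Ey.
have m1 : measurable_fun setT (fun xi => (\int[mu]_(x in E) (1 + 1 * cos (dot x xi + th))%:E)%E).
  pose f (p : 'rV[R]_n * 'rV[R]_n) : \bar R :=
    ((1 + 1 * cos (dot p.2 p.1 + th)) * \1_E p.2)%:E.
  have f0 p : (0 <= f p)%E.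
    by rewrite /f lee_fin mulr_ge0// mul1r cos_add1_ge0.
  have mf : measurable_fun setT f.
    apply/measurable_EFinP/measurable_funM; last first.
      exact: measurable_indic_snd.
    apply: measurable_funD => //; apply: measurable_funM => //.
    exact: measurable_cos_dot.
  have := measurable_fun_fubini_tonelli_F (m2 := mu) f mf f0.
  apply: eq_measurable_fun => xi _; rewrite /fubini_F [RHS]integral_mkcond.
  apply: eq_integral => x _; rewrite /f patchE indicE.
  by case: ifPn => xE; rewrite ?mulr1 ?mulr0.
rewrite (_ : trig E th = fun xi =>
    fine (\int[mu]_(x in E) (1 + 1 * cos (dot x xi + th))%:E)%E - fine (mu E)).
  apply: measurable_funB => //.
  exact: (measurableT_comp (fine_measurable measurableT)).
by apply/funext => xi; rewrite trig_tonelli ?normr1//= mul1r addrAC subrr add0r.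
Qed.

Definition smoothing eps E : 'rV[R]_n -> R := convolution (gauss_eps eps) \1_E.

Section smoothing_props.
Variables (eps : R) (E : set 'rV[R]_n).
Hypotheses (e0 : 0 < eps) (mE : measurable E) (Ey : (mu E < +oo)%E).

Lemma smoothing_EFin x : ((smoothing eps E x)%:E =
  \int[mu]_(y in E) (gauss_eps eps (x - y))%:E)%E.
Proof.
have mg : measurable_fun setT (fun y => gauss_eps eps (x - y)).
  by apply: measurable_gauss_eps => //; exact: measurable_subrV.
have e : (\int[mu]_(y in E) (gauss_eps eps (x - y))%:E =
    \int[mu]_y (gauss_eps eps (x - y) * \1_E y)%:E)%E.
  rewrite integral_mkcond; apply: eq_integral => y _; rewrite patchE indicE.
  by case: ifPn => yE; rewrite ?mulr1 ?mulr0.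
rewrite /smoothing /convolution /Rintegral e fineK// ge0_fin_numE; last first.
  by apply: integral_ge0 => y _; rewrite lee_fin mulr_ge0// gauss_eps_ge0.
rewrite -e; apply: (@le_lt_trans _ _ (\int[mu]_y (gauss_eps eps (x - y))%:E)%E).
  apply: ge0_subset_integral => //; first exact/measurable_EFinP.
  by move=> y _; rewrite lee_fin gauss_eps_ge0.
by rewrite integral_gauss_epsr// ltry.
Qed.

Lemma smoothing_ge0 x : 0 <= smoothing eps E x.
Proof.
rewrite -lee_fin smoothing_EFin; apply: integral_ge0 => y _.
by rewrite lee_fin gauss_eps_ge0.
Qed.

Lemma smoothing_le1 x : smoothing eps E x <= 1.
Proof.
rewrite -lee_fin smoothing_EFin -(integral_gauss_epsr x e0).
apply: ge0_subset_integral => //; last by move=> y _; rewrite lee_fin gauss_eps_ge0.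
by apply/measurable_EFinP; apply: measurable_gauss_eps => //; exact: measurable_subrV.
Qed.

Lemma measurable_smoothing : measurable_fun setT (smoothing eps E).
Proof.
pose f (p : 'rV[R]_n * 'rV[R]_n) : \bar R := (gauss_eps eps (p.1 - p.2) * \1_E p.2)%:E.
have f0 p : (0 <= f p)%E by rewrite /f lee_fin mulr_ge0// gauss_eps_ge0.
have mf : measurable_fun setT f.
  apply/measurable_EFinP/measurable_funM; last first.
    exact: measurable_indic_snd.
  by apply: measurable_gauss_eps => //; exact: measurable_subrV.
have := measurable_fun_fubini_tonelli_F (m2 := mu) f mf f0.
by move=> /(measurableT_comp (fine_measurable measurableT)).
Qed.

(** The Fourier transform turns the convolution into a product: by Tonelli's theorem the integral in
    x is done first, and it damps the cosine by the transform of the Gaussian. The case b = 0 gives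
    the mass, and b = 1 then gives the cosine integral. *)
Lemma integral_smoothing_cos xi th (b : R) : `|b| <= 1 ->
  (\int[mu]_x (smoothing eps E x * (1 + b * cos (dot x xi + th)))%:E =
   (fine (mu E) + b * (expR (- (eps ^+ 2 * dot xi xi / 2)) * trig E th xi))%:E)%E.
Proof.
move=> b1.
have bc0 x : 0 <= 1 + b * cos (dot x xi + th).
  suff : `|b * cos (dot x xi + th)| <= 1 by rewrite ler_norml; lra.
  by rewrite normrM mulr_ile1// norm_cos_le1.
pose f (p : 'rV[R]_n * 'rV[R]_n) : \bar R :=
  (gauss_eps eps (p.1 - p.2) * (1 + b * cos (dot p.1 xi + th)) * \1_E p.2)%:E.
have f0 p : (0 <= f p)%E.
  rewrite /f lee_fin; apply: mulr_ge0 => //; apply: mulr_ge0 => //.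
  exact: gauss_eps_ge0.
have mf : measurable_fun setT f.
  apply/measurable_EFinP/measurable_funM; last first.
    exact: measurable_indic_snd.
  apply: measurable_funM.
    by apply: measurable_gauss_eps => //; exact: measurable_subrV.
  apply: measurable_funD => //; apply: measurable_funM => //.
  by apply: measurable_cos_dot => //; exact: measurableT_comp.
transitivity (\int[mu]_x \int[mu]_y f (x, y))%E.
  apply: eq_integral => x _; rewrite mulrC EFinM smoothing_EFin -ge0_integralZl//; last 3 first.
  - apply/measurable_funTS/measurable_EFinP; apply: measurable_gauss_eps => //.
    exact: measurable_subrV.
  - by move=> y _; rewrite lee_fin gauss_eps_ge0.
  - by rewrite lee_fin.
  rewrite integral_mkcond; apply: eq_integral => y _; rewrite /f /= patchE indicE.
  case: ifPn => yE; last by rewrite mulr0.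
  by rewrite -EFinM mulr1 [in LHS]mulrC.
rewrite (fubini_tonelli (m1 := mu) (m2 := mu) f mf f0).
have en : `|b * expR (- (eps ^+ 2 * dot xi xi / 2))| <= 1.
  rewrite normrM mulr_ile1// ger0_norm ?expR_ge0// -expR0 ler_expR oppr_le0.
  by rewrite divr_ge0// mulr_ge0 ?sqr_ge0// dot_ge0.
rewrite mulrA -trig_tonelli// [RHS]integral_mkcond.
apply: eq_integral => y _; rewrite patchE /f /= indicE; case: ifPn => yE.
  rewrite -mulrA -integral_gauss_eps_cos//.
  by apply: eq_integral => x _; rewrite mulr1.
by rewrite integral0_eq// => x _; rewrite mulr0.
Qed.

Lemma integral_smoothing : (\int[mu]_x (smoothing eps E x)%:E = mu E)%E.
Proof.
have := @integral_smoothing_cos 0 0 0; rewrite normr0 => /(_ ler01).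
rewrite mul0r addr0 finite_measure_fineK// => <-.
by apply: eq_integral => x _; rewrite mul0r addr0 mulr1.
Qed.

Lemma integrable_smoothing : mu.-integrable setT (EFin \o smoothing eps E).
Proof.
apply/integrableP; split; first by apply/measurable_EFinP; exact: measurable_smoothing.
under eq_integral do rewrite /= ger0_norm ?smoothing_ge0//.
by rewrite integral_smoothing.
Qed.

Lemma Rintegral_smoothing_cos xi th :
  \int[mu]_x (smoothing eps E x * cos (dot x xi + th)) =
  expR (- (eps ^+ 2 * dot xi xi / 2)) * trig E th xi.
Proof.
have := @integral_smoothing_cos xi th 1; rewrite normr1 => /(_ (lexx _)).
move=> /(congr1 fine) /=.
have is_ := integrable_smoothing.
have isc : mu.-integrable setT (EFin \o (fun x => smoothing eps E x * cos (dot x xi + th))).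
  apply: le_integrable_EFin is_ => //.
    by apply: measurable_funM; [exact: measurable_smoothing|exact: measurable_cos_dot].
  by move=> x _; rewrite normrM (ger0_norm (smoothing_ge0 _)) ler_piMr ?smoothing_ge0 ?norm_cos_le1.
rewrite -/(Rintegral _ _ _); under eq_Rintegral do rewrite mul1r mulrDr mulr1.
rewrite RintegralD//= {1}/Rintegral integral_smoothing mul1r.
by move/addrI.
Qed.

End smoothing_props.

End smoothing.

Section fourier_swap.
Context {R : realType} {n : nat}.
Local Notation mu := (@lebesgue_rV R n).
Implicit Types (x xi : 'rV[R]_n) (u phi : 'rV[R]_n -> R) (th : R).

Lemma integrable_mul_cos phi (f : 'rV[R]_n -> R) : mu.-integrable setT (EFin \o phi) ->
  measurable_fun setT f ->
  mu.-integrable setT (EFin \o (fun xi => phi xi * cos (f xi))).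
Proof.
move=> ip mf; apply: le_integrable_EFin (integrable_norm ip) => //.
  apply: measurable_funM; first by apply/measurable_EFinP; exact: measurable_int ip.
  exact: (measurableT_comp measurable_cos).
by move=> xi _; rewrite normrM ler_piMr// norm_cos_le1.
Qed.

(** The multiplication formula, moving the Fourier transform from one factor to the other. Fubini's
    theorem applies because the kernel is bounded by 1 and |u| |phi| is integrable on the product.
    Integrability is part of the conclusion because complex integrals are later split into real
    ones. *)
Lemma fourier_swap u phi th : mu.-integrable setT (EFin \o u) ->
  mu.-integrable setT (EFin \o phi) ->
  mu.-integrable setT
    (EFin \o (fun x => u x * \int[mu]_xi (phi xi * cos (dot x xi + th)))) /\
  \int[mu]_x (u x * \int[mu]_xi (phi xi * cos (dot x xi + th))) =
  \int[mu]_xi (phi xi * \int[mu]_x (u x * cos (dot x xi + th))).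
Proof.
move=> iu ip.
have mu_ : measurable_fun setT u by apply/measurable_EFinP; exact: measurable_int iu.
have mp : measurable_fun setT phi by apply/measurable_EFinP; exact: measurable_int ip.
pose f (p : 'rV[R]_n * 'rV[R]_n) : \bar R :=
  (u p.1 * (phi p.2 * cos (dot p.1 p.2 + th)))%:E.
have mf : measurable_fun setT f.
  apply/measurable_EFinP; apply: measurable_funM.
    exact: (measurableT_comp mu_ measurable_fst).
  apply: measurable_funM; first exact: (measurableT_comp mp measurable_snd).
  exact: measurable_cos_dot.
have if_ : ((mu \x mu)%E).-integrable setT f.
  apply/(integrable12ltyP mu mu mf).
  apply: (@le_lt_trans _ _ (\int[mu]_x (`|u x|%:E * \int[mu]_xi `|phi xi|%:E))%E).
    apply: ge0_le_integral => //.
    - by move=> x _; exact: integral_ge0.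
    - apply: measurable_fun_fubini_tonelli_F (abse \o f) _ _.
        exact: measurableT_comp.
      by move=> p; exact: abse_ge0.
    - apply: emeasurable_funM => //; apply/measurable_EFinP.
      exact: measurableT_comp.
    - move=> x _; rewrite -ge0_integralZl//; last first.
        by apply/measurable_EFinP; exact: measurableT_comp.
      apply: ge0_le_integral => //.
      + apply: measurableT_comp => //; apply/measurable_EFinP => /=.
        apply: measurable_funM => //; apply: measurable_funM => //.
        exact: measurable_cos_dot.
      + by apply: emeasurable_funM => //; apply/measurable_EFinP; exact: measurableT_comp.
      + move=> xi _; rewrite /f /= lee_fin !normrM ler_wpM2l//.
        by rewrite ler_piMr// norm_cos_le1.
  rewrite ge0_integralZr//.
  - apply: lte_mul_pinfty; first exact: integral_ge0.
      rewrite ge0_fin_numE; last exact: integral_ge0.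
      by have /integrableP[_] := iu.
    by have /integrableP[_] := ip.
  - by apply/measurable_EFinP; exact: measurableT_comp.
  - exact: integral_ge0.
have FE x : (fubini_F mu f x = (u x * \int[mu]_xi (phi xi * cos (dot x xi + th)))%:E)%E.
  rewrite /fubini_F /f /=; have ic := @integrable_mul_cos phi (fun xi => dot x xi + th) ip.
  rewrite -RintegralZl//; last by apply: ic; apply: measurable_funD => //; exact: measurable_dot.
  rewrite /Rintegral fineK//; apply: integrable_fin_num => //.
  by apply: integrable_EFinZl => //; apply: ic; apply: measurable_funD => //; exact: measurable_dot.
have GE xi : (fubini_G mu f xi = (phi xi * \int[mu]_x (u x * cos (dot x xi + th)))%:E)%E.
  rewrite /fubini_G /f /=; have ic := @integrable_mul_cos u (fun x => dot x xi + th) iu.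
  rewrite -RintegralZl//; last by apply: ic; apply: measurable_funD => //; exact: measurable_dot.
  under eq_integral do rewrite mulrCA.
  rewrite /Rintegral fineK//; apply: integrable_fin_num => //.
  by apply: integrable_EFinZl => //; apply: ic; apply: measurable_funD => //; exact: measurable_dot.
have {}FE := funext FE; have {}GE := funext GE.
split.
- by have := integrable_fubini_F if_; rewrite FE.
- have := Fubini if_; rewrite -/(fubini_F mu f) -/(fubini_G mu f) FE GE.
  by rewrite /Rintegral => ->.
Qed.

Lemma fourier_swap_integrable u phi th : mu.-integrable setT (EFin \o u) ->
  mu.-integrable setT (EFin \o phi) ->
  mu.-integrable setT
    (EFin \o (fun xi => phi xi * \int[mu]_x (u x * cos (dot x xi + th)))).
Proof.
move=> iu ip; have [] := fourier_swap th ip iu.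
rewrite (_ : (fun x => phi x * _) = fun xi => phi xi * \int[mu]_x (u x * cos (dot x xi + th)))//.
apply/funext => xi; congr (_ * _); apply: eq_Rintegral => x _.
by rewrite dotC.
Qed.

End fourier_swap.

Lemma continuous_bigsum (R : realType) (T : topologicalType) (I : Type)
    (r : seq I) (f : I -> T -> R) :
  (forall i, continuous (f i)) -> continuous (fun x => \sum_(i <- r) f i x).
Proof.
move=> cf; elim: r => [|i r ih] x.
  by under eq_fun do rewrite big_nil; exact: cvg_cst.
rewrite (_ : (fun _ => _) = fun y => f i y + \sum_(i <- r) f i y).
  by apply: cvgD; [exact: cf|exact: ih].
by apply/funext => y; rewrite big_cons.
Qed.

Lemma continuous_bigprod (R : realType) (T : topologicalType) (I : Type)
    (r : seq I) (P : pred I) (f : I -> T -> R) :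
  (forall i, continuous (f i)) ->
  continuous (fun x => \prod_(i <- r | P i) f i x).
Proof.
move=> cf; elim: r => [|i r ih] x.
  by under eq_fun do rewrite big_nil; exact: cvg_cst.
rewrite (_ : (fun _ => _) = fun y => (if P i then f i y else 1) *
    \prod_(i <- r | P i) f i y).
  by apply: cvgM; [case: (P i); [exact: cf|exact: cvg_cst]|exact: ih].
by apply/funext => y; rewrite big_cons; case: (P i); rewrite ?mul1r.
Qed.

(** * From the energy to the H^(1/2) norm *)

Section Hhalf_bound.
Context {R : realType} {n : nat}.
Local Notation mu := (@lebesgue_rV R n).
Implicit Types (x xi : 'rV[R]_n) (phi : 'rV[R]_n -> R) (E : set 'rV[R]_n).

Lemma continuous_dot : continuous (fun x : 'rV[R]_n => dot x x).
Proof.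
apply: continuous_bigsum => i x.
by apply: continuousM; exact: coord_continuous.
Qed.

(** phi e^(|x|^2) is continuous, hence bounded on [K], so that phi is dominated by a multiple of the
    integrable function e^(-|x|^2). *)
Lemma continuous_compact_support_integrable phi (K : set 'rV[R]_n) :
  continuous phi -> compact K -> (forall x, ~ K x -> phi x = 0) ->
  mu.-integrable setT (EFin \o phi).
Proof.
move=> cphi cK phi0.
pose h x := phi x * expR (dot x x).
have ch : continuous h.
  move=> x; have := @continuousM R 'rV[R]_n phi (fun x => expR (dot x x)) x (cphi x).
  apply.
  by apply: continuous_comp; [exact: continuous_dot|exact: continuous_expR].
have /compact_bounded[M [_ hM]] : compact (h @` K).
  by apply: continuous_compact => //; exact: continuous_subspaceT.
pose C := M + 1.
have hC x : K x -> `|h x| <= C.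
  by move=> Kx; apply: (hM C); [rewrite /C; lra|exists x].
have i1 := integrable_EFinZl measurableT `|C| (@integrable_expRN_dot R n 1 ltr01).
apply: le_integrable_EFin i1 => //; first exact: continuous_rV_measurable.
move=> x _; have [Kx|nKx] := pselect (K x); last first.
  by rewrite phi0// normr0 mulr_ge0// expR_ge0.
rewrite mul1r expRN ler_pdivlMr ?expR_gt0//.
rewrite -[X in _ * X]ger0_norm ?expR_ge0// -normrM (le_trans (hC _ Kx))//.
exact: ler_norm.
Qed.

(* The weight is the square of the Fourier transform e^(- eps^2 |xi|^2 / 2) of the
   Gaussian. *)
Definition gauss_energy (eps : R) E : \bar R :=
  (\int[mu]_xi (enorm xi * (expR (- (eps ^+ 2 * dot xi xi)) *
    (trig E 0 xi ^+ 2 + trig E (- (pi / 2)) xi ^+ 2)))%:E)%E.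

Lemma measurable_enorm : measurable_fun setT (@enorm R n).
Proof.
apply: (measurableT_comp (f := @Num.sqrt R)).
  by apply: continuous_measurable_fun; exact: sqrt_continuous.
exact: measurable_dot.
Qed.

Lemma cos_subpihalf (t : R) : cos (t - pi / 2) = sin t.
Proof. by rewrite cosB cos_pihalf sin_pihalf mulr0 mulr1 add0r. Qed.

Section bound.
Variables (eps : R) (E : set 'rV[R]_n).
Hypotheses (e0 : 0 < eps) (mE : measurable E) (Ey : (mu E < +oo)%E).

(** The Fourier transform of gamma_eps * 1_E, the function to be exhibited in the infimum that
    defines the norm. *)
Let g xi : R[i] :=
  Complex (expR (- (eps ^+ 2 * dot xi xi / 2)) * trig E 0 xi)
          (- (expR (- (eps ^+ 2 * dot xi xi / 2)) * trig E (- (pi / 2)) xi)).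

Let measurable_expRN_half : measurable_fun setT
  (fun xi : 'rV[R]_n => expR (- (eps ^+ 2 * dot xi xi / 2))).
Proof.
apply: measurableT_comp => //; apply: measurableT_comp => //.
by apply: measurable_funM => //; apply: measurable_funM => //; exact: measurable_dot.
Qed.

Let cnorm2_g xi : cnorm2 (g xi) = expR (- (eps ^+ 2 * dot xi xi)) *
  (trig E 0 xi ^+ 2 + trig E (- (pi / 2)) xi ^+ 2).
Proof.
rewrite /cnorm2 /g /= sqrrN !exprMn -mulrDr; congr (_ * _).
by rewrite expr2 -expRD; congr expR; field.
Qed.

Let measurable_cnorm2_g : measurable_fun setT (fun xi => cnorm2 (g xi)).
Proof.
apply: measurable_funD; apply: measurable_funX.
  by apply: measurable_funM => //; exact: measurable_trig.
by apply: measurableT_comp => //; apply: measurable_funM => //; exact: measurable_trig.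
Qed.

Let cnorm2_g_ge0 xi : 0 <= cnorm2 (g xi).
Proof. by rewrite /cnorm2 addr_ge0 ?sqr_ge0. Qed.

Let g_L2 : locally_L2 (~` [set 0]) g.
Proof.
have mg1 : measurable_fun setT (fun xi => expR (- (eps ^+ 2 * dot xi xi / 2)) * trig E 0 xi).
  by apply: measurable_funM => //; exact: measurable_trig.
have mg2 : measurable_fun setT (fun xi =>
    expR (- (eps ^+ 2 * dot xi xi / 2)) * trig E (- (pi / 2)) xi).
  by apply: measurable_funM => //; exact: measurable_trig.
split.
- exact: measurable_funTS.
- by apply: measurable_funTS; exact: measurableT_comp.
- move=> K cK _.
  have mK : measurable K.
    rewrite -[K]setCK; apply: measurableC; apply: open_rV_measurable.
    by rewrite openC; apply: compact_closed => //; exact: norm_hausdorff.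
  apply: (@le_lt_trans _ _ (\int[mu]_xi (cnorm2 (g xi))%:E)%E).
    apply: ge0_subset_integral => //; first exact/measurable_EFinP.
    by move=> x _; rewrite lee_fin.
  have i1 := @integrable_expRN_dot R n _ (exprn_gt0 2 e0).
  have i2 := integrable_EFinZl measurableT (2 * fine (mu E) ^+ 2) i1.
  have : mu.-integrable setT (EFin \o (fun xi => cnorm2 (g xi))).
    apply: le_integrable_EFin i2 => // xi _.
    rewrite ger0_norm// cnorm2_g mulrC ler_wpM2r ?expR_ge0//.
    have h th : trig E th xi ^+ 2 <= fine (mu E) ^+ 2.
      by rewrite -real_normK ?num_real// lerXn2r ?nnegrE ?fine_ge0 ?trig_bound.
    by rewrite mulr_natl mulr2n lerD.
  move=> /integrableP[_]; under eq_integral do rewrite /= ger0_norm//.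
  by [].
Qed.

(** Splitting phi into [p1] + i [p2], and e^(-i t) into cosines of phases 0 and - pi / 2, reduces
    the identity to real integrals [F p th]. Each of them is moved to the other side by
    [fourier_swap], where it becomes [W p th]. *)
Let g_distr : distr_is_on (~` [set 0])
  (fourier_distr (fun x => (smoothing eps E x)%:C%C)) g.
Proof.
move=> phi [c1 c2 cK _].
pose p1 xi := complex.Re (phi xi); pose p2 xi := complex.Im (phi xi).
have supp x : ~ tsupport phi x -> phi x = 0.
  move=> nx; apply/eqP; apply: contra_notT nx => px.
  exact: subset_closure.
have i1 : mu.-integrable setT (EFin \o p1).
  apply: continuous_compact_support_integrable cK _; first by have [] := c1 0%N.
  by move=> x /supp; rewrite /p1 => ->.
have i2 : mu.-integrable setT (EFin \o p2).
  apply: continuous_compact_support_integrable cK _; first by have [] := c2 0%N.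
  by move=> x /supp; rewrite /p2 => ->.
have iu := integrable_smoothing e0 mE Ey.
pose F (p : 'rV[R]_n -> R) th x := \int[mu]_xi (p xi * cos (dot x xi + th)).
have ic (p : 'rV[R]_n -> R) th x : mu.-integrable setT (EFin \o p) ->
    mu.-integrable setT (EFin \o (fun xi => p xi * cos (dot x xi + th))).
  move=> ip; apply: integrable_mul_cos => //; apply: measurable_funD => //.
  exact: measurable_dot.
have phiE xi : phi xi = Complex (p1 xi) (p2 xi) by rewrite /p1 /p2; case: (phi xi).
have fE x : fourier phi x = Complex (F p1 0 x + F p2 (- (pi / 2)) x)
    (F p2 0 x - F p1 (- (pi / 2)) x).
  rewrite /fourier /cintegral; congr Complex.
    rewrite -RintegralD ?ic//; apply: eq_Rintegral => xi _.
    by rewrite phiE /= addr0 cos_subpihalf dotC; ring.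
  rewrite -RintegralB ?ic//; apply: eq_Rintegral => xi _.
  by rewrite phiE /= addr0 cos_subpihalf dotC; ring.
pose W (p : 'rV[R]_n -> R) th := \int[mu]_xi (p xi *
  (expR (- (eps ^+ 2 * dot xi xi / 2)) * trig E th xi)).
have iF p th : mu.-integrable setT (EFin \o p) ->
    mu.-integrable setT (EFin \o (fun x => smoothing eps E x * F p th x)).
  by move=> ip; have [] := fourier_swap th iu ip.
have iW p th : mu.-integrable setT (EFin \o p) ->
    mu.-integrable setT (EFin \o (fun xi => p xi *
       (expR (- (eps ^+ 2 * dot xi xi / 2)) * trig E th xi))).
  move=> ip; have := fourier_swap_integrable th iu ip.
  by under eq_fun do rewrite Rintegral_smoothing_cos//.
have FW p th : mu.-integrable setT (EFin \o p) ->
    \int[mu]_x (smoothing eps E x * F p th x) = W p th.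
  move=> ip; have [_ ->] := fourier_swap th iu ip.
  by apply: eq_Rintegral => xi _; rewrite Rintegral_smoothing_cos.
rewrite /fourier_distr /cintegral; congr Complex.
  transitivity (W p1 0 + W p2 (- (pi / 2))).
    rewrite -!FW// -RintegralD ?iF//; apply: eq_Rintegral => x _.
    by rewrite fE /=; ring.
  rewrite -RintegralD ?iW//; apply: eq_Rintegral => xi _.
  by rewrite phiE /g /=; ring.
transitivity (W p2 0 - W p1 (- (pi / 2))).
  rewrite -!FW// -RintegralB ?iF//; apply: eq_Rintegral => x _.
  by rewrite fE /=; ring.
rewrite -RintegralB ?iW//; apply: eq_Rintegral => xi _.
by rewrite phiE /g /=; ring.
Qed.

(** [g] is admissible in the infimum, and its weighted integral off the origin is at most the one
    over the whole space. *)
Lemma Hhalf_norm2_le :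
  (Hhalf_norm2 (fun x => (smoothing eps E x)%:C%C) <= gauss_energy eps E)%E.
Proof.
have h : (Hhalf_norm2 (fun x => (smoothing eps E x)%:C%C) <=
    \int[mu]_(xi in ~` [set 0%R]) (enorm xi * cnorm2 (g xi))%:E)%E.
  by apply: ereal_inf_lbound; exists g.
apply: le_trans h _.
have -> : gauss_energy eps E = (\int[mu]_xi (enorm xi * cnorm2 (g xi))%:E)%E.
  by apply: eq_integral => xi _; rewrite cnorm2_g.
apply: ge0_subset_integral => //.
- apply: open_rV_measurable; rewrite openC.
  by apply: compact_closed; [exact: norm_hausdorff|exact: compact_set1].
- by apply/measurable_EFinP/measurable_funM => //; exact: measurable_enorm.
- by move=> xi _; rewrite lee_fin mulr_ge0// sqrtr_ge0.
Qed.

End bound.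

Lemma Hhalf_norm2_ge0 (u : 'rV[R]_n -> R[i]) : (0 <= Hhalf_norm2 u)%E.
Proof.
apply: le_ereal_inf_tmp => _ [g _ <-]; apply: integral_ge0 => xi _.
by rewrite lee_fin mulr_ge0 ?sqrtr_ge0// addr_ge0 ?sqr_ge0.
Qed.

End Hhalf_bound.

(** * Sets of small energy *)

Section approximate_identity.
Context {R : realType} {n : nat}.
Local Notation mu := (@lebesgue_rV R n).
Implicit Types (x y : 'rV[R]_n) (E : set 'rV[R]_n).

Lemma sqr_coord_le_dot x i : x ord0 i ^+ 2 <= dot x x.
Proof.
rewrite /dot (bigD1 i)//= expr2 lerDl; apply: sumr_ge0 => j _.
by rewrite -expr2 sqr_ge0.
Qed.

Lemma open_rV_dotP E x : open E -> E x ->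
  exists2 r : R, 0 < r & forall y, dot (x - y) (x - y) < r ^+ 2 -> E y.
Proof.
move=> oE Ex.
have /nbhs_ballP[e /= e0 xe] : nbhs x E by exact: open_nbhs_nbhs.
exists e => // y xy; apply: xe; rewrite mx_norm_ball /ball_/=.
rewrite [ltLHS](_ : _ = mx_norm (x - y))// mx_normrE.
apply/bigmax_ltP => /=; split => // -[i j] _ /=; rewrite ord1.
rewrite -(@ltr_pXn2r _ 2) ?nnegrE ?(ltW e0)// real_normK ?num_real//.
exact: le_lt_trans (sqr_coord_le_dot _ _) xy.
Qed.

(** Chebyshev's inequality: the deficit is the Gaussian mass of the complement of [E], where |x -
    y|^2 / r^2 >= 1. *)
Lemma smoothing_ge eps E x (r : R) : 0 < eps -> measurable E -> 0 < r ->
  (forall y, dot (x - y) (x - y) < r ^+ 2 -> E y) ->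
  1 - smoothing eps E x <= 4 * Num.sqrt 2 ^+ n * eps ^+ 2 / r ^+ 2.
Proof.
move=> e0 mE r0 hr.
have t0 : 0 < Num.sqrt 2 * eps by rewrite mulr_gt0// sqrtr_gt0.
have mg e : 0 < e -> measurable_fun setT (fun y => (gauss_eps e (x - y))%:E).
  move=> ?; apply/measurable_EFinP; apply: measurable_gauss_eps => //.
  exact: measurable_subrV.
have mCE : measurable (~` E) by exact: measurableC.
set K := 4 * Num.sqrt 2 ^+ n * eps ^+ 2 / r ^+ 2.
have K0 : 0 <= K by rewrite !mulr_ge0 ?invr_ge0 ?exprn_ge0 ?sqrtr_ge0 ?ltW.
rewrite lerBlDl -lee_fin EFinD smoothing_EFin// -(integral_gauss_epsr x e0).
rewrite -[in leLHS](setUv E) ge0_integral_setU//; last 3 first.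
- exact: measurable_funTS (mg _ e0).
- by move=> y _; rewrite lee_fin gauss_eps_ge0.
- by apply/disj_setPS => y [].
apply: leeD => //.
apply: (@le_trans _ _ (\int[mu]_(y in ~` E) (K%:E * (gauss_eps (Num.sqrt 2 * eps) (x - y))%:E))%E).
  apply: ge0_le_integral => //.
  - by move=> y _; rewrite lee_fin gauss_eps_ge0.
  - exact: measurable_funTS (mg _ e0).
  - by apply: measurable_funTS; apply: emeasurable_funM => //; exact: mg.
  - move=> y nEy; rewrite -EFinM lee_fin.
    have h : r ^+ 2 <= dot (x - y) (x - y) by rewrite leNgt; apply/negP => /hr.
    rewrite /K mulrAC ler_pdivlMr ?exprn_gt0//.
    apply: le_trans (gauss_eps_second_moment (x - y) e0).
    by rewrite mulrC ler_wpM2r// gauss_eps_ge0.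
rewrite ge0_integralZl//; last 2 first.
- exact: measurable_funTS (mg _ t0).
- by move=> y _; rewrite lee_fin gauss_eps_ge0.
rewrite -[leRHS]mule1; apply: lee_wpmul2l; first by rewrite lee_fin.
rewrite -(integral_gauss_epsr x t0); apply: ge0_subset_integral => //; first exact: mg.
by move=> y _; rewrite lee_fin gauss_eps_ge0.
Qed.

(** Every point of the open set [E] has a ball inside [E], so the tail estimate gives convergence at
    each point; the constant 1 dominates on a set of finite measure. *)
Lemma integral_one_sub_smoothing_cvg0 E : open E -> (mu E < +oo)%E ->
  (\int[mu]_(x in E) (1 - smoothing k.+1%:R^-1 E x)%:E)%E @[k --> \oo] --> 0%E.
Proof.
move=> oE Ey; have mE := open_rV_measurable oE.
have d0 (k : nat) : 0 < k.+1%:R^-1 :> R by rewrite invr_gt0.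
have [] := @dominated_convergence _ _ _ mu E mE
  (fun k x => (1 - smoothing k.+1%:R^-1 E x)%:E) (cst 0%E) (cst 1%E).
- move=> k; apply: measurable_funTS; apply/measurable_EFinP.
  by apply: measurable_funB => //; exact: measurable_smoothing.
- exact: measurable_cst.
- apply/aeW => x Ex; have [r r0 hr] := open_rV_dotP oE Ex.
  apply: cvg_EFin; first exact: nearW.
  pose K := 4 * Num.sqrt 2 ^+ n / r ^+ 2.
  have h : K * (k.+1%:R^-1 * k.+1%:R^-1) @[k --> \oo] --> K * (0 * 0).
    apply: cvgMr; apply: cvgM; exact: cvg_harmonic.
  rewrite mulr0 mulr0 in h.
  apply: (squeeze_cvgr _ (cvg_cst 0) h); apply: nearW => k.
  rewrite subr_ge0 smoothing_le1//=; apply: le_trans (smoothing_ge _ _ _ hr) _ => //.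
  by rewrite -expr2 /K mulrAC.
- have := @integrable_bounded_on R n E (cst 1) 1 mE Ey (measurable_cst _).
  by apply => x; rewrite normr1.
- apply/aeW => x k Ex; rewrite /= lee_fin ger0_norm ?subr_ge0 ?smoothing_le1//.
  by rewrite gerBl smoothing_ge0.
by move=> _ _; rewrite integral0.
Qed.

(** Smoothing preserves the total mass, so the mass that leaks out of [E] equals the deficit inside.
    The L^1 distance is therefore twice the deficit, whence eta / 2. *)
Lemma L1_smoothing_lt E (eta : R) : open E -> (mu E < +oo)%E -> 0 < eta ->
  exists2 delta, 0 < delta &
    (\int[mu]_x (`|smoothing delta E x - \1_E x|)%:E < eta%:E)%E.
Proof.
move=> oE Ey eta0; have mE := open_rV_measurable oE.
have mCE : measurable (~` E) by exact: measurableC.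
have /fine_cvgP[] := integral_one_sub_smoothing_cvg0 oE Ey.
move=> fnum /cvgr0Pnorm_lt /(_ (eta / 2)); rewrite divr_gt0// => /(_ isT).
move=> hlt; have [k [fk hk]] : exists k : nat,
   (\int[mu]_(x in E) (1 - smoothing k.+1%:R^-1 E x)%:E)%E \is a fin_num /\
   `|fine (\int[mu]_(x in E) (1 - smoothing k.+1%:R^-1 E x)%:E)%E| < eta / 2.
  by apply: (@filter_ex _ \oo); apply: filterI.
have d0 : 0 < k.+1%:R^-1 :> R by rewrite invr_gt0.
exists k.+1%:R^-1 => //; set f := smoothing k.+1%:R^-1 E in fk hk *.
have f0 x : 0 <= f x by exact: smoothing_ge0.
have f1 x : f x <= 1 by exact: smoothing_le1.
have mf : measurable_fun setT f by exact: measurable_smoothing.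
rewrite -(setUv E) ge0_integral_setU//; last 2 first.
- apply/measurable_EFinP/measurable_funTS; apply: measurableT_comp => //.
  by apply: measurable_funB => //; exact: measurable_indic.
- by apply/disj_setPS => y [].
have iE : (\int[mu]_(x in E) (`|f x - \1_E x|)%:E = \int[mu]_(x in E) (1 - f x)%:E)%E.
  apply: eq_integral => x xE; rewrite indicE xE distrC ger0_norm// subr_ge0.
  exact: f1.
have iCE : (\int[mu]_(x in ~` E) (`|f x - \1_E x|)%:E = \int[mu]_(x in ~` E) (f x)%:E)%E.
  apply: eq_integral => x; rewrite inE => nEx; rewrite indicE memNset// subr0.
  by rewrite ger0_norm.
have iff : (\int[mu]_(x in ~` E) (f x)%:E = \int[mu]_(x in E) (1 - f x)%:E)%E.
  have e1 : (\int[mu]_(x in E) (f x)%:E + \int[mu]_(x in ~` E) (f x)%:E = mu E)%E.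
    rewrite -ge0_integral_setU//; last 3 first.
    - by apply/measurable_EFinP/measurable_funTS.
    - by move=> x _; rewrite lee_fin.
    - by apply/disj_setPS => y [].
    by rewrite setUv integral_smoothing.
  have e2 : (\int[mu]_(x in E) (f x)%:E + \int[mu]_(x in E) (1 - f x)%:E = mu E)%E.
    rewrite -ge0_integralD//; last 4 first.
    - by move=> x _; rewrite lee_fin.
    - by apply/measurable_EFinP/measurable_funTS.
    - by move=> x _; rewrite lee_fin subr_ge0.
    - by apply/measurable_EFinP/measurable_funTS; exact: measurable_funB.
    under eq_integral do rewrite -EFinD addrC subrK.
    by rewrite integral_cst// mul1e.
  have ffin : (\int[mu]_(x in E) (f x)%:E)%E \is a fin_num.
    rewrite ge0_fin_numE; last by apply: integral_ge0 => x _; rewrite lee_fin.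
    apply: le_lt_trans Ey; rewrite -e1 leeDl//.
    by apply: integral_ge0 => x _; rewrite lee_fin.
  move: e1; rewrite -e2 addeC [RHS]addeC.
  by move=> /(congr1 (fun z => z - \int[mu]_(x in E) (f x)%:E)%E); rewrite !addeK.
rewrite iE iCE iff -(fineK fk) -EFinD lte_fin.
by move: hk => /(le_lt_trans (ler_norm _)); lra.
Qed.

End approximate_identity.

Lemma cos_lipschitz (R : realType) (a b : R) : `|cos a - cos b| <= `|a - b|.
Proof.
wlog ab : a b / a <= b.
  by move=> h; case: (leP a b) => [/h//|/ltW/h]; rewrite distrC [leRHS]distrC.
have [c _ e] : exists2 c, c \in `[a, b] & cos b - cos a = - sin c * (b - a).
  apply: MVT_segment => //.
  by apply: continuous_subspaceT; exact: continuous_cos.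
rewrite distrC e normrM normrN distrC ler_piMl//.
by rewrite ler_norml sin_geN1 sin_le1.
Qed.

(** * Grids, and sets with prescribed mass in each cell *)

Section boxes.
Context {R : realType} {n : nat}.
Local Notation mu := (@lebesgue_rV R n).
Local Notation leb := (@lebesgue_measure R).
Implicit Types (A : 'I_n -> set R) (x : 'rV[R]_n).

Definition rV_box A : set 'rV[R]_n := [set x | forall i, A i (x ord0 i)].

Lemma measurable_rV_box A : (forall i, measurable (A i)) -> measurable (rV_box A).
Proof.
move=> mA; rewrite (_ : rV_box A = \bigcap_(i in [set: 'I_n])
    ((fun x : 'rV[R]_n => x ord0 i) @^-1` A i)); last first.
  by apply/seteqP; split => x /= h i; [move=> _|]; exact: h.
apply: fin_bigcap_measurable => // i _.
by rewrite -[X in measurable X]setTI; exact: measurable_rV_coord.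
Qed.

Lemma open_rV_box A : (forall i, open (A i)) -> open (rV_box A).
Proof.
move=> oA; rewrite openE => x hx; exists (fun _ i => A i) => [i j|y hy i].
  by rewrite ord1; apply: open_nbhs_nbhs; split => //; exact: hx.
exact: hy.
Qed.

Lemma closed_rV_box A : (forall i, closed (A i)) -> closed (rV_box A).
Proof.
move=> cA; rewrite (_ : rV_box A = \bigcap_(i in [set: 'I_n])
    ((fun x : 'rV[R]_n => x ord0 i) @^-1` A i)); last first.
  by apply/seteqP; split => x /= h i; [move=> _|]; exact: h.
apply: closed_bigI => i _; apply: closed_comp => // x _.
exact: coord_continuous.
Qed.

Lemma hyperplane_null i (c : R) : mu [set x | x ord0 i = c] = 0%E.
Proof.
rewrite [X in mu X](_ : _ = rV_box (fun j => if j == i then [set c] else setT)).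
  rewrite lebesgue_rV_box; last by move=> j; case: ifP.
  by rewrite (bigD1 i)//= eqxx lebesgue_measure_set1 mul0e.
apply/seteqP; split => x /=; last by move=> /(_ i); rewrite eqxx.
by move=> xc j; case: eqP => [->|].
Qed.

End boxes.

Section grid.
Context {R : realType} {n : nat}.
Variables (i0 : 'I_n) (h : R).
Hypothesis h0 : 0 < h.
Local Notation mu := (@lebesgue_rV R n).
Local Notation leb := (@lebesgue_measure R).
Implicit Types (x xi : 'rV[R]_n) (z : 'rV[int]_n) (E S A : set 'rV[R]_n).

(** Open sides keep the sets built inside the cells open; the omitted faces form a null set. *)
Let side z i : set R := `](z ord0 i)%:~R * h, (z ord0 i)%:~R * h + h[%classic.

Definition cell z : set 'rV[R]_n := rV_box (side z).

Let leb_side z i : (leb (side z i) = h%:E)%E.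
Proof.
rewrite lebesgue_measure_itv/= lte_fin ltrDl h0 -EFinB.
by congr EFin; ring.
Qed.

Lemma measurable_cell z : measurable (cell z).
Proof. by apply: measurable_rV_box => i; exact: measurable_itv. Qed.

Lemma open_cell z : open (cell z).
Proof. by apply: open_rV_box => i; exact: interval_open. Qed.

Lemma cell_lty z : (mu (cell z) < +oo)%E.
Proof.
rewrite lebesgue_rV_box; last by move=> i; exact: measurable_itv.
by under eq_bigr do rewrite leb_side; rewrite prodEFin ltry.
Qed.

(** An enumeration by [nat], so that countable additivity applies directly; a number that codes no
    integer vector yields the empty set. *)
Definition grid_cell (k : nat) : set 'rV[R]_n :=
  if pickle_inv k is Some z then cell z else set0.

Lemma measurable_grid_cell k : measurable (grid_cell k).
Proof. by rewrite /grid_cell; case: pickle_inv => [z|//]; exact: measurable_cell. Qed.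

Lemma grid_cell_lty k : (mu (grid_cell k) < +oo)%E.
Proof. by rewrite /grid_cell; case: pickle_inv => [z|]; rewrite ?measure0//; exact: cell_lty. Qed.

Lemma cell_floor z x : cell z x -> z = \row_i Num.floor (x ord0 i / h).
Proof.
move=> zx; apply/rowP => i; rewrite mxE; apply/esym/floor_def.
have := zx i; rewrite /side /= in_itv/= => /andP[a b].
rewrite ler_pdivlMr// ltr_pdivrMr// (ltW a)/=.
by rewrite intrD mulrDl mul1r.
Qed.

Lemma trivIset_grid_cell : trivIset setT grid_cell.
Proof.
move=> k l _ _ [x []]; rewrite /grid_cell.
have := @pickle_invK 'rV[int]_n k; have := @pickle_invK 'rV[int]_n l.
case: (pickle_inv k) => // z; case: (pickle_inv l) => // w /= <- <-.
by move=> /cell_floor -> /cell_floor ->.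
Qed.

(** A point outside all open cells has a coordinate in h Z, hence lies on one of countably many null
    hyperplanes, enumerated by [W]. *)
Lemma grid_cells_conull : mu (~` \bigcup_k grid_cell k) = 0%E.
Proof.
have mU : measurable (\bigcup_k grid_cell k).
  by apply: bigcupT_measurable => k; exact: measurable_grid_cell.
apply: measure_negligible; first exact: measurableC.
pose W (k : nat) : set 'rV[R]_n :=
  if (pickle_inv k : option ('I_n * int)) is Some p
  then [set x | x ord0 p.1 = p.2%:~R * h] else set0.
have Wnull : mu.-negligible (\bigcup_k W k).
  apply: negligible_bigcup => k; rewrite /W; case: pickle_inv => [[i z]|].
    apply/negligibleP; last exact: hyperplane_null.
    rewrite [X in measurable X](_ : _ = setT `&`
      (fun x : 'rV[R]_n => x ord0 i) @^-1` [set z%:~R * h]).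
      by apply: measurable_rV_coord.
    by rewrite setTI.
  exact: negligible_set0.
apply: negligibleS Wnull => x nx.
apply: contrapT => nW; apply: nx.
exists (pickle (\row_i Num.floor (x ord0 i / h))) => //.
rewrite /grid_cell pickleK_inv => i; rewrite /side /= in_itv/= mxE.
have /andP[a b] := floor_itv (x ord0 i / h).
rewrite ler_pdivlMr// in a; rewrite ltr_pdivrMr// intrD mulrDl mul1r in b.
rewrite b andbT lt_neqAle a andbT; apply/eqP => e; apply: nW.
by exists (pickle (i, Num.floor (x ord0 i / h))) => //; rewrite /W pickleK_inv/=.
Qed.

Lemma le_integral_grid (f g : 'rV[R]_n -> \bar R) :
  measurable_fun setT f -> measurable_fun setT g ->
  (forall x, 0 <= f x)%E -> (forall x, 0 <= g x)%E ->
  (forall k, \int[mu]_(x in grid_cell k) f x <= \int[mu]_(x in grid_cell k) g x)%E ->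
  (\int[mu]_x f x <= \int[mu]_x g x)%E.
Proof.
move=> mf mg f0 g0 fg.
have mU : measurable (\bigcup_k grid_cell k).
  by apply: bigcupT_measurable => k; exact: measurable_grid_cell.
have e (k : 'rV[R]_n -> \bar R) : measurable_fun setT k -> (forall x, 0 <= k x)%E ->
    (\int[mu]_x k x = \sum_(0 <= i <oo) \int[mu]_(x in grid_cell i) k x)%E.
  move=> mk k0.
  rewrite (ge0_negligible_integral (measurableC mU) measurableT mk)//;
    last exact: grid_cells_conull.
  rewrite setDE setCK setTI ge0_integral_bigcup//.
  - exact: measurable_grid_cell.
  - exact: measurable_funTS.
  - exact: trivIset_grid_cell.
rewrite e// [leRHS]e//; apply: lee_nneseries => [i _ _|i _]; last exact: fg.
exact: integral_ge0.
Qed.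

Definition halfspace (t : R) : set 'rV[R]_n := [set x | x ord0 i0 < t].

Lemma measurable_halfspace t : measurable (halfspace t).
Proof. by apply: measurable_set_lt; exact: measurable_rV_coord. Qed.

Lemma open_halfspace t : open (halfspace t).
Proof.
rewrite (_ : halfspace t = (fun x : 'rV[R]_n => x ord0 i0) @^-1` `]-oo, t[%classic).
  apply: open_comp; last exact: interval_open.
  by move=> x _; exact: coord_continuous.
by apply/seteqP; split => x /=; rewrite in_itv.
Qed.

(* The measure of A below the hyperplane of height t is Lipschitz in t, because A
   lies in a cell. *)
Lemma cell_cut z A (v : R) : measurable A -> A `<=` cell z ->
  0 <= v <= fine (mu A) -> exists t, mu (A `&` halfspace t) = v%:E.
Proof.
move=> mA Az v01.
have AH_fin t : mu (A `&` halfspace t) \is a fin_num.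
  rewrite ge0_fin_numE//; apply: le_lt_trans (cell_lty z).
  apply: le_measure; rewrite ?inE; last by move=> x [/Az].
    by apply: measurableI => //; exact: measurable_halfspace.
  exact: measurable_cell.
pose m t := fine (mu (A `&` halfspace t)).
pose C := \prod_(i < n | i != i0) h.
have C0 : 0 <= C by apply: prodr_ge0 => i _; exact: ltW.
have lip s t : s <= t -> 0 <= m t - m s <= C * (t - s).
  move=> st.
  (* The part of [A] between the heights s and t lies in this box, of volume C (t - s). *)
  pose B i := if i == i0 then `[s, t[%classic else side z i.
  have mB i : measurable (B i) by rewrite /B; case: ifP => _; exact: measurable_itv.
  have muB : mu (rV_box B) = (C * (t - s))%:E.
    rewrite lebesgue_rV_box// (bigD1 i0)//= {1}/B eqxx lebesgue_measure_itv/=.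
    rewrite (eq_bigr (fun=> h%:E)); last by move=> i /negbTE ni; rewrite /B ni leb_side.
    rewrite prodEFin -/C lte_fin; case: ltP => ts; first by rewrite -EFinB -EFinM mulrC.
    by rewrite mul0e (_ : t = s) ?subrr ?mulr0//; apply/eqP; rewrite eq_le ts st.
  have AHt : A `&` halfspace t = (A `&` halfspace s) `|` (A `&` (halfspace t `\` halfspace s)).
    apply/seteqP; split => x /=.
      by move=> [Ax xt]; have [xs|xs] := pselect (halfspace s x); [left|right].
    move=> [[Ax xs]|[Ax [xt _]]] //; split => //.
    exact: lt_le_trans st.
  have mHD : measurable (A `&` (halfspace t `\` halfspace s)).
    by apply: measurableI => //; apply: measurableD; exact: measurable_halfspace.
  have mAs : measurable (A `&` halfspace s).
    by apply: measurableI => //; exact: measurable_halfspace.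
  have e : (mu (A `&` halfspace t) = mu (A `&` halfspace s) +
      mu (A `&` (halfspace t `\` halfspace s)))%E.
    by rewrite AHt measureU//; apply/seteqP; split => x //= -[[_ xs] [_ [_]]].
  have le : (mu (A `&` (halfspace t `\` halfspace s)) <= (C * (t - s))%:E)%E.
    rewrite -muB; apply: le_measure; rewrite ?inE//; first exact: measurable_rV_box.
    move=> x [/Az zx [xt /negP]]; rewrite -leNgt => xs i; rewrite /B.
    by case: eqP => [->|_]; [rewrite /= in_itv/= xs|exact: zx].
  have fD : mu (A `&` (halfspace t `\` halfspace s)) \is a fin_num.
    by rewrite ge0_fin_numE// (le_lt_trans le)// ltry.
  rewrite /m e fineD//= addrAC subrr add0r fine_ge0//=.
  by rewrite -lee_fin fineK.
have lipn s t : `|m t - m s| <= C * `|t - s|.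
  have [st|/ltW ts] := leP s t.
    by have /andP[a b] := lip _ _ st; rewrite !ger0_norm// subr_ge0.
  have /andP[a b] := lip _ _ ts; rewrite distrC (distrC t s).
  by rewrite !ger0_norm// subr_ge0.
have cm : continuous m.
  move=> t; apply/cvgrPdist_lt => e e0.
  near=> s; apply: le_lt_trans (lipn _ _) _.
  apply: (@le_lt_trans _ _ ((C + 1) * `|t - s|)).
    by rewrite ler_wpM2r// lerDl.
  rewrite mulrC -ltr_pdivlMr ?ltr_wpDl//.
  near: s; apply: cvgr_dist_lt => //.
  by rewrite divr_gt0// ltr_wpDl.
set a := (z ord0 i0)%:~R * h.
have ma : m a = 0.
  rewrite /m (_ : _ `&` _ = set0) ?measure0//.
  apply/seteqP; split => x //= -[/Az /(_ i0)]; rewrite /side /= in_itv/= -/a => /andP[+ _].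
  by rewrite /halfspace /= => /ltW; rewrite leNgt => /negP.
have mb : m (a + h) = fine (mu A).
  rewrite /m (_ : _ `&` _ = A)//.
  apply/seteqP; split => x //=; first by case.
  move=> Ax; split => //; have := Az _ Ax i0.
  by rewrite /side /= in_itv/= -/a => /andP[].
have [|||t _ mt] := @IVT R m a (a + h) v.
- by rewrite lerDl ltW.
- by apply: continuous_subspaceT.
- rewrite ma mb; case/andP: v01 => v0 v1.
  by rewrite ge_min le_max v0 v1 orbT.
by exists t; rewrite -mt fineK.
Unshelve. all: by end_near. Qed.

(** The least possible change of E reaches the mass [v]: if E has too much mass in the cell, it is
    cut by a half-space; otherwise the missing mass is added by cutting the rest of the cell. In the
    second case the set is written as the cell intersected with the union of E and a half-space,
    which is open although the added piece alone need not be. *)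
Lemma grid_cell_fill k E (v : R) : open E -> 0 <= v <= fine (mu (grid_cell k)) ->
  exists S, [/\ open S, S `<=` grid_cell k, mu S = v%:E &
    mu (grid_cell k `&` setY E S) = `|fine (mu (grid_cell k `&` E)) - v|%:E].
Proof.
move=> oE; rewrite /grid_cell; case: pickle_inv => [z|]; last first.
  rewrite measure0/= -eq_le => /eqP <-; exists set0.
  by rewrite !set0I measure0 /= subrr normr0; split => //; exact: open0.
have mE := open_rV_measurable oE; set c := cell z.
have mc : measurable c by exact: measurable_cell.
have oc : open c by exact: open_cell.
have sub_fin B : measurable B -> B `<=` c -> mu B \is a fin_num.
  move=> mB Bc; rewrite ge0_fin_numE//; apply: le_lt_trans (cell_lty z).
  by apply: le_measure; rewrite ?inE.
have mcE : measurable (c `&` E) by exact: measurableI.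
have mcD : measurable (c `\` E) by exact: measurableD.
have fcE := sub_fin _ mcE (@subIsetl _ _ _).
have fcD := sub_fin _ mcD (@subDsetl _ _ _).
have ec : mu c = (mu (c `&` E) + mu (c `\` E))%E.
  by rewrite -measureU// ?setUIDK//; apply/seteqP; split => x //= -[[_ ?] []].
move=> /andP[v0 v1]; have [va|va] := leP v (fine (mu (c `&` E))).
- have [|t Ht] := @cell_cut z (c `&` E) v mcE (@subIsetl _ _ _); first by rewrite v0.
  have mS : measurable (c `&` E `&` halfspace t).
    by apply: measurableI => //; exact: measurable_halfspace.
  exists (c `&` E `&` halfspace t); split => //.
  + by apply: openI; [exact: openI|exact: open_halfspace].
  + by move=> x [[]].
  + rewrite (_ : _ `&` setY _ _ = (c `&` E) `\` (c `&` E `&` halfspace t)).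
      rewrite measureD//; last by rewrite -ge0_fin_numE.
      rewrite [X in (_ - mu X)%E]setIidr; last exact: subIsetl.
      by rewrite Ht ger0_norm ?subr_ge0// EFinB fineK.
    apply/seteqP; split => x /=; rewrite /setY /=; last by tauto.
    by move=> [cx [[Ex nx]|[[[_ ?] _] ?]]] //; split.
- have [|t Ht] := @cell_cut z (c `\` E) (v - fine (mu (c `&` E))) mcD (@subDsetl _ _ _).
    rewrite subr_ge0 (ltW va)/= lerBlDl -lee_fin EFinD !fineK// -ec.
    by rewrite -[leRHS]fineK ?lee_fin// sub_fin.
  exists (c `&` (E `|` halfspace t)); split => //.
  + by apply: openI => //; apply: openU => //; exact: open_halfspace.
  + rewrite (_ : _ `&` _ = (c `&` E) `|` ((c `\` E) `&` halfspace t)).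
      have -> : (mu ((c `&` E) `|` ((c `\` E) `&` halfspace t)) =
          mu (c `&` E) + mu ((c `\` E) `&` halfspace t))%E.
        rewrite measureU//.
          by apply: measurableI => //; exact: measurable_halfspace.
        by apply/seteqP; split => x //= -[[_ ?] [[_ ?]]].
      by rewrite Ht -[mu (c `&` E)]fineK// -EFinD/= addrC subrK.
    apply/seteqP; split => x /=; last by tauto.
    by move=> [cx [Ex|Hx]]; have [Ex'|nEx] := pselect (E x); [left|left|left|right].
  + rewrite (_ : _ `&` setY _ _ = (c `\` E) `&` halfspace t).
      by rewrite Ht distrC ger0_norm// subr_ge0 ltW.
    apply/seteqP; split => x /=; rewrite /setY /=; last by tauto.
    by move=> [cx [[Ex []]|[[_ [|]]]]] //; tauto.
Qed.

(** Each cell receives the mass [v k] of f. The change made there is |int (1_E - f)| over the cell,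
    at most the integral of |f - 1_E|; hence the whole change is controlled by an L^1 distance,
    whatever the mesh. *)
Lemma grid_fill E (f : 'rV[R]_n -> R) : open E -> (mu E < +oo)%E ->
  mu.-integrable setT (EFin \o f) -> (forall x, 0 <= f x <= 1) ->
  exists S, [/\ open S, (mu S < +oo)%E,
    (mu (setY E S) <= \int[mu]_x `|f x - \1_E x|%:E)%E &
    forall k, (\int[mu]_(x in grid_cell k) (\1_S x)%:E =
               \int[mu]_(x in grid_cell k) (f x)%:E)%E].
Proof.
move=> oE Ey fi f01; have mE := open_rV_measurable oE.
have f0 x : 0 <= f x by case/andP: (f01 x).
have mf : measurable_fun setT f by apply/measurable_EFinP; exact: measurable_int fi.
have mc := measurable_grid_cell.
have fik k : mu.-integrable (grid_cell k) (EFin \o f).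
  exact: integrableS (measurableT) (mc k) _ fi.
pose v k := \int[mu]_(x in grid_cell k) f x.
have vE k : (\int[mu]_(x in grid_cell k) (f x)%:E = (v k)%:E)%E.
  by rewrite /v /Rintegral fineK//; exact: integrable_fin_num.
have v01 k : 0 <= v k <= fine (mu (grid_cell k)).
  rewrite Rintegral_ge0//=.
  rewrite -[leRHS]mul1r -Rintegral_cst//; apply: le_Rintegral => //.
    apply: (@integrable_bounded_on _ _ _ _ 1) => //; first exact: grid_cell_lty.
    by move=> x; rewrite normr1.
  by move=> x _; case/andP: (f01 x).
have [S hS] := choice (fun k => grid_cell_fill oE (v01 k)).
have oS k : open (S k) by have [] := hS k.
have Sc k : S k `<=` grid_cell k by have [] := hS k.
have muS k : mu (S k) = (v k)%:E by have [] := hS k.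
have muY k : mu (grid_cell k `&` setY E (S k)) =
    `|fine (mu (grid_cell k `&` E)) - v k|%:E by have [] := hS k.
pose U := \bigcup_k S k.
have oU : open U by exact: bigcup_open.
have mU := open_rV_measurable oU.
have UI k : U `&` grid_cell k = S k.
  apply/seteqP; split => [x [[l _ Slx] cx]|x Sx]; last by split; [exists k|exact: Sc].
  suff <- : l = k by [].
  have := @trivIset_grid_cell l k I I; apply.
  by exists x; split; [exact: Sc|].
have indU k : (\int[mu]_(x in grid_cell k) (\1_U x)%:E = \int[mu]_(x in grid_cell k) (f x)%:E)%E.
  by rewrite integral_indic// UI vE; exact: muS.
have mY : measurable (setY E U) by apply: measurableU; exact: measurableD.
exists U; split => //.
- have -> : mu U = (\int[mu]_x (\1_U x)%:E)%E by rewrite integral_indic// setIT.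
  apply: (@le_lt_trans _ _ (\int[mu]_x (f x)%:E)%E).
    apply: le_integral_grid => //.
    + by apply/measurable_EFinP; exact: measurable_indic.
    + exact/measurable_EFinP.
    + by move=> k; rewrite indU.
  have /integrableP[_] := fi.
  by under eq_integral do rewrite /= ger0_norm//.
- have -> : mu (setY E U) = (\int[mu]_x (\1_(setY E U) x)%:E)%E.
    by rewrite integral_indic// setIT.
  apply: le_integral_grid.
  + by apply/measurable_EFinP; exact: measurable_indic.
  + apply/measurable_EFinP; apply: measurableT_comp => //.
    by apply: measurable_funB => //; exact: measurable_indic.
  + by move=> x; rewrite lee_fin.
  + by move=> x; rewrite lee_fin.
  + move=> k; rewrite integral_indic// setIC.
    rewrite (_ : _ `&` setY E U = grid_cell k `&` setY E (S k)); last first.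
      rewrite -(UI k); apply/seteqP; split => x; rewrite /setY /=; tauto.
    have i1 : mu.-integrable (grid_cell k) (EFin \o \1_E).
      apply: (@integrable_bounded_on _ _ _ _ 1) => //; first exact: grid_cell_lty.
      by move=> x; rewrite indicE; case: (_ \in _); rewrite ?normr1 ?normr0.
    rewrite [leLHS](muY k).
    have -> : fine (mu (grid_cell k `&` E)) = \int[mu]_(x in grid_cell k) \1_E x.
      by rewrite /Rintegral integral_indic// setIC.
    rewrite distrC /v -RintegralB// EFin_normr_Rintegral//; last exact: integrable_EFinB.
    apply: le_abse_integral => //; apply/measurable_funTS/measurable_EFinP.
    by apply: measurable_funB => //; exact: measurable_indic.
Qed.

(** On a cell the factor 1 + cos stays within [L] of its value at the corner [p]. Freezing it costs
    [L], equal masses allow f to be exchanged for g, and unfreezing costs [L] again. *)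
Lemma le_integral_grid_cos (f g : 'rV[R]_n -> R) (th : R) xi :
  measurable_fun setT f -> measurable_fun setT g ->
  (forall x, 0 <= f x) -> (forall x, 0 <= g x) ->
  (forall k, (\int[mu]_(x in grid_cell k) (f x)%:E =
              \int[mu]_(x in grid_cell k) (g x)%:E)%E) ->
  (\int[mu]_x (f x * (1 + cos (dot x xi + th)))%:E <=
   \int[mu]_x (g x * (1 + cos (dot x xi + th)))%:E +
   (2 * (h * \sum_i `|xi ord0 i|))%:E * \int[mu]_x (g x)%:E)%E.
Proof.
move=> mf mg f0 g0 fg; set L := h * _.
have L0 : 0 <= L by rewrite mulr_ge0 ?(ltW h0)// sumr_ge0.
pose c x := 1 + cos (dot x xi + th).
have c0 x : 0 <= c x by exact: cos_add1_ge0.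
have mc : measurable_fun setT c.
  by apply: measurable_funD => //; exact: measurable_cos_dot.
have gL0 x : 0 <= 2 * L * g x by apply: mulr_ge0 => //; exact: mulr_ge0.
have mgc : measurable_fun setT (fun x => (g x * c x)%:E).
  by apply/measurable_EFinP; exact: measurable_funM.
have mLg : measurable_fun setT (fun x => (2 * L * g x)%:E).
  by apply/measurable_EFinP; exact: measurable_funM.
rewrite -ge0_integralZl//; last 3 first.
- exact/measurable_EFinP.
- by move=> x _; rewrite lee_fin.
- by rewrite lee_fin mulr_ge0.
rewrite -ge0_integralD//; last 2 first.
- by move=> x _; rewrite lee_fin mulr_ge0// c0.
- by move=> x _; rewrite -EFinM lee_fin.
apply: le_integral_grid.
- by apply/measurable_EFinP; exact: measurable_funM.
- exact: emeasurable_funD.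
- by move=> x; rewrite lee_fin mulr_ge0// c0.
- move=> x; rewrite -EFinM -EFinD lee_fin; apply: addr_ge0 => //.
  exact: mulr_ge0 (g0 x) (c0 x).
move=> k; rewrite /grid_cell in fg *; move: (fg k).
case: pickle_inv => [z|_]; last by rewrite !integral_set0.
pose p := \row_i ((z ord0 i)%:~R * h) : 'rV[R]_n.
have cL x : cell z x -> `|c x - c p| <= L.
  move=> zx; rewrite /c opprD addrACA subrr add0r.
  apply: le_trans (cos_lipschitz _ _) _.
  rewrite opprD addrACA subrr addr0 /dot -sumrB.
  apply: le_trans (ler_norm_sum _ _ _) _; rewrite /L mulr_sumr; apply: ler_sum => i _.
  rewrite -mulrBl normrM ler_wpM2r// mxE.
  have := zx i; rewrite /side /= in_itv/= => /andP[a b].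
  by rewrite ger0_norm; [rewrite lerBlDl ltW|rewrite subr_ge0 ltW].
have mcell := measurable_cell z.
move=> fgz; apply: (@le_trans _ _ (\int[mu]_(x in cell z) ((c p + L)%:E * (f x)%:E))%E).
  apply: ge0_le_integral => //.
  - by move=> x _; rewrite lee_fin mulr_ge0// c0.
  - by apply/measurable_funTS/measurable_EFinP; exact: measurable_funM.
  - by apply/measurable_funTS/measurable_EFinP; exact: measurable_funM.
  - move=> x zx; rewrite lee_fin mulrC ler_wpM2r//.
    by have := cL x zx; rewrite ler_norml => /andP[_]; rewrite lerBlDl.
have cpL : 0 <= c p + L by rewrite addr_ge0// c0.
rewrite ge0_integralZl//; last 2 first.
- exact/measurable_funTS/measurable_EFinP.
- by move=> x _; rewrite lee_fin.
rewrite fgz -ge0_integralZl//; last 2 first.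
- exact/measurable_funTS/measurable_EFinP.
- by move=> x _; rewrite lee_fin.
apply: ge0_le_integral => //.
- by move=> x _; rewrite lee_fin mulr_ge0.
- by apply/measurable_funTS/measurable_EFinP; exact: measurable_funM.
- by apply/measurable_funTS; exact: emeasurable_funD.
- move=> x zx; rewrite -!EFinM -EFinD lee_fin.
  have := cL x zx; rewrite ler_norml => /andP[+ _]; have := g0 x.
  rewrite -/(c x); nra.
Qed.

(** The one-sided estimate is used twice with the roles of f and g exchanged; the contributions of
    the added 1 cancel because the total masses agree. *)
Lemma grid_cos_close (f g : 'rV[R]_n -> R) (th : R) xi :
  mu.-integrable setT (EFin \o f) -> mu.-integrable setT (EFin \o g) ->
  (forall x, 0 <= f x) -> (forall x, 0 <= g x) ->
  (forall k, (\int[mu]_(x in grid_cell k) (f x)%:E =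
              \int[mu]_(x in grid_cell k) (g x)%:E)%E) ->
  `|\int[mu]_x (f x * cos (dot x xi + th)) - \int[mu]_x (g x * cos (dot x xi + th))| <=
    2 * (h * \sum_i `|xi ord0 i|) * \int[mu]_x f x.
Proof.
move=> fi gi f0 g0 fg; set L := h * _.
have mf : measurable_fun setT f by apply/measurable_EFinP; exact: measurable_int fi.
have mg : measurable_fun setT g by apply/measurable_EFinP; exact: measurable_int gi.
have efg : (\int[mu]_x (f x)%:E = \int[mu]_x (g x)%:E)%E.
  apply/eqP; rewrite eq_le; apply/andP; split; apply: le_integral_grid => //;
    try exact/measurable_EFinP; try by move=> x; rewrite lee_fin.
  - by move=> k; rewrite fg.
  - by move=> k; rewrite fg.
have EQ (q : 'rV[R]_n -> R) : mu.-integrable setT (EFin \o q) ->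
    ((\int[mu]_x q x)%:E = \int[mu]_x (q x)%:E)%E.
  by move=> qi; rewrite /Rintegral fineK//; exact: integrable_fin_num.
have ic (q : 'rV[R]_n -> R) : mu.-integrable setT (EFin \o q) ->
    mu.-integrable setT (EFin \o (fun x => q x * cos (dot x xi + th))).
  move=> qi; apply: integrable_mul_cos => //; apply: measurable_funD => //.
  exact: measurable_dot.
have sp (q : 'rV[R]_n -> R) : mu.-integrable setT (EFin \o q) ->
    (\int[mu]_x (q x * (1 + cos (dot x xi + th)))%:E =
     (\int[mu]_x q x + \int[mu]_x (q x * cos (dot x xi + th)))%:E)%E.
  move=> qi; rewrite -RintegralD//; last exact: ic.
  rewrite EQ; last by apply: integrable_EFinD => //; exact: ic.
  by apply: eq_integral => x _; rewrite mulrDr mulr1.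
have h1 := @le_integral_grid_cos f g th xi mf mg f0 g0 fg.
have h2 := @le_integral_grid_cos g f th xi mg mf g0 f0 (fun k => esym (fg k)).
rewrite -efg -/L !sp// -EQ// -EFinM -EFinD lee_fin in h1.
rewrite -/L !sp// -EQ// -EFinM -EFinD lee_fin in h2.
have e' : \int[mu]_x f x = \int[mu]_x g x by rewrite /Rintegral efg.
rewrite ler_norml -/L; apply/andP; split; move: h1 h2; rewrite -e'; lra.
Qed.

End grid.

(** * Energy estimates at a fixed scale *)

Section energy.
Context {R : realType} {n : nat}.
Local Notation mu := (@lebesgue_rV R n).
Implicit Types (x xi : 'rV[R]_n) (E S : set 'rV[R]_n) (eps th : R).

(** The constant C_eps. One factor 1 + |xi|^2 bounds the weight |xi|, and the other bounds the
    growth of the squared error in the transform. *)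
Definition gauss_weight eps : R :=
  \int[mu]_xi ((1 + dot xi xi) ^+ 2 * expR (- (eps ^+ 2 * dot xi xi))).

Lemma gauss_weight_ge0 eps : 0 <= gauss_weight eps.
Proof. by apply: Rintegral_ge0 => xi _; rewrite mulr_ge0 ?sqr_ge0 ?expR_ge0. Qed.

Lemma sqr_enorm xi : enorm xi ^+ 2 = dot xi xi.
Proof. by rewrite /enorm sqr_sqrtr// dot_ge0. Qed.

Lemma enorm_ge0 xi : 0 <= enorm xi.
Proof. exact: sqrtr_ge0. Qed.

Lemma enorm_le xi : enorm xi <= 1 + dot xi xi.
Proof. by rewrite -sqr_enorm; have := enorm_ge0 xi; nra. Qed.

Lemma coord_le_enorm xi i : `|xi ord0 i| <= enorm xi.
Proof.
rewrite -(@ler_pXn2r _ 2) ?nnegrE ?enorm_ge0// sqr_enorm real_normK ?num_real//.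
exact: sqr_coord_le_dot.
Qed.

Lemma measurable_expRN_dot (a : R) :
  measurable_fun setT (fun xi : 'rV[R]_n => expR (- (a * dot xi xi))).
Proof.
apply: measurableT_comp => //; apply: measurableT_comp => //.
by apply: measurable_funM => //; exact: measurable_dot.
Qed.

(** For each phase t^2 <= 2 A^2 + 2 (t - A)^2, and the two errors add up to 4 c (1 + |xi|^2). The
    form c (1 + |xi|^2) covers both uses: a uniform error from a change of the set, and an error of
    order h |xi| from the grid. *)
Lemma gauss_energy_perturb eps E (A B : 'rV[R]_n -> R) (c : R) : 0 < eps ->
  measurable E -> (mu E < +oo)%E ->
  measurable_fun setT A -> measurable_fun setT B ->
  (forall xi, (trig E 0 xi - A xi) ^+ 2 <= c * (1 + dot xi xi)) ->
  (forall xi, (trig E (- (pi / 2)) xi - B xi) ^+ 2 <= c * (1 + dot xi xi)) ->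
  (gauss_energy eps E <= 2%:E * \int[mu]_xi (enorm xi *
      (expR (- (eps ^+ 2 * dot xi xi)) * (A xi ^+ 2 + B xi ^+ 2)))%:E +
    (4 * c * gauss_weight eps)%:E)%E.
Proof.
move=> e0 mE Ey mA mB hA hB.
have q0 xi : 0 <= dot xi xi by exact: dot_ge0.
have c0 : 0 <= c.
  by have := le_trans (sqr_ge0 _) (hA 0); rewrite dot0r addr0 mulr1.
have iw := @integrable_poly_expRN_dot R n _ (exprn_gt0 2 e0).
pose w xi := (1 + dot xi xi) ^+ 2 * expR (- (eps ^+ 2 * dot xi xi)).
have w0 xi : 0 <= w xi by rewrite /w mulr_ge0 ?sqr_ge0 ?expR_ge0.
have mw : measurable_fun setT w by apply/measurable_EFinP; exact: measurable_int iw.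
have -> : ((4 * c * gauss_weight eps)%:E = \int[mu]_xi (4 * c * w xi)%:E)%E.
  rewrite EFinM /gauss_weight /Rintegral fineK; last exact: integrable_fin_num.
  rewrite -ge0_integralZl//.
  - exact/measurable_EFinP.
  - by move=> xi _; rewrite lee_fin w0.
  - by rewrite lee_fin mulr_ge0.
pose g xi := enorm xi * (expR (- (eps ^+ 2 * dot xi xi)) * (A xi ^+ 2 + B xi ^+ 2)).
have g0 xi : 0 <= g xi.
  by rewrite /g mulr_ge0 ?enorm_ge0// mulr_ge0 ?expR_ge0// addr_ge0 ?sqr_ge0.
have mg : measurable_fun setT g.
  apply: measurable_funM; first exact: measurable_enorm.
  apply: measurable_funM; first exact: measurable_expRN_dot.
  by apply: measurable_funD; exact: measurable_funX.
rewrite -ge0_integralZl//; last 2 first.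
- exact/measurable_EFinP.
- by move=> xi _; rewrite lee_fin g0.
rewrite -ge0_integralD//; last 4 first.
- by move=> xi _; rewrite -EFinM lee_fin; apply: mulr_ge0 => //; exact: g0.
- by apply: emeasurable_funM => //; exact/measurable_EFinP.
- by move=> xi _; rewrite lee_fin; apply: mulr_ge0 (w0 _); rewrite mulr_ge0.
- by apply/measurable_EFinP; exact: measurable_funM.
apply: ge0_le_integral => //.
- move=> xi _; rewrite lee_fin mulr_ge0 ?enorm_ge0// mulr_ge0 ?expR_ge0//.
  by rewrite addr_ge0 ?sqr_ge0.
- apply/measurable_EFinP; apply: measurable_funM; first exact: measurable_enorm.
  apply: measurable_funM; first exact: measurable_expRN_dot.
  by apply: measurable_funD; apply: measurable_funX; exact: measurable_trig.
- apply: emeasurable_funD; first by apply: emeasurable_funM => //; exact/measurable_EFinP.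
  by apply/measurable_EFinP; exact: measurable_funM.
move=> xi _; rewrite -EFinM -EFinD lee_fin /g /w.
set q := dot xi xi; set e := expR _; set t := trig E 0 xi; set s := trig E _ xi.
have e_ge0 : 0 <= e by exact: expR_ge0.
have hq : 0 <= q by exact: q0.
have h1 : t ^+ 2 + s ^+ 2 <= 2 * (A xi ^+ 2 + B xi ^+ 2) + 4 * c * (1 + q).
  have := hA xi; have := hB xi; rewrite -/t -/s -/q.
  have := sqr_ge0 (t - 2 * A xi); have := sqr_ge0 (s - 2 * B xi); nra.
apply: (@le_trans _ _ (enorm xi * (e * (2 * (A xi ^+ 2 + B xi ^+ 2) + 4 * c * (1 + q))))).
  by rewrite ler_wpM2l ?enorm_ge0// ler_wpM2l.
have -> : enorm xi * (e * (2 * (A xi ^+ 2 + B xi ^+ 2) + 4 * c * (1 + q))) =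
  2 * (enorm xi * (e * (A xi ^+ 2 + B xi ^+ 2))) +
  4 * c * (enorm xi * (1 + q) * e) by ring.
rewrite lerD2l ler_wpM2l ?mulr_ge0// ler_wpM2r// expr2.
by rewrite ler_wpM2r ?enorm_le// addr_ge0.
Qed.

Lemma trig_indic E th xi : trig E th xi = \int[mu]_x (\1_E x * cos (dot x xi + th)).
Proof.
rewrite /trig Rintegral_mkcond; apply: eq_Rintegral => x _.
by rewrite patchE indicE; case: ifPn => _; rewrite ?mul1r ?mul0r.
Qed.

Lemma integrable_indic_fin E : measurable E -> (mu E < +oo)%E ->
  mu.-integrable setT (EFin \o (\1_E : 'rV[R]_n -> R)).
Proof.
move=> mE Ey; apply/integrableP; split.
  by apply/measurable_EFinP; exact: measurable_indic.
under eq_integral do rewrite /= ger0_norm//.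
by rewrite integral_indic// setIT.
Qed.

Lemma gauss_energy_lty eps E : 0 < eps -> measurable E -> (mu E < +oo)%E ->
  (gauss_energy eps E < +oo)%E.
Proof.
move=> e0 mE Ey.
have h th xi : (trig E th xi - 0) ^+ 2 <= fine (mu E) ^+ 2 * (1 + dot xi xi).
  rewrite subr0 -[leLHS]mulr1 ler_pM ?sqr_ge0//; last by rewrite lerDl dot_ge0.
  by rewrite -real_normK ?num_real// lerXn2r ?nnegrE ?fine_ge0 ?trig_bound.
apply: le_lt_trans (@gauss_energy_perturb eps E (cst 0) (cst 0) _ e0 mE Ey _ _ (h 0) (h _)) _ => //.
rewrite integral0_eq ?mule0 ?add0e ?ltry// => xi _.
by rewrite /cst expr0n/= addr0 !mulr0.
Qed.

Lemma trig_setY E S th xi : measurable E -> (mu E < +oo)%E ->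
  measurable S -> (mu S < +oo)%E ->
  `|trig S th xi - trig E th xi| <= fine (mu (setY E S)).
Proof.
move=> mE Ey mS Sy.
have iE := integrable_indic_fin mE Ey; have iS := integrable_indic_fin mS Sy.
have ic (A : set 'rV[R]_n) : mu.-integrable setT (EFin \o \1_A) ->
    mu.-integrable setT (EFin \o (fun x => \1_A x * cos (dot x xi + th))).
  move=> iA; apply: (integrable_mul_cos iA (f := fun x => dot x xi + th)).
  by apply: measurable_funD => //; exact: measurable_dot.
have mY : measurable (setY E S) by apply: measurableU; exact: measurableD.
rewrite !trig_indic -RintegralB//; [|exact: ic|exact: ic].
apply: le_trans (le_normr_Rintegral _ _) _ => //.
  by apply: integrable_EFinB => //; exact: ic.
have -> : fine (mu (setY E S)) = \int[mu]_x \1_(setY E S) x.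
  by rewrite /Rintegral integral_indic// setIT.
have Yy : (mu (setY E S) < +oo)%E.
  apply: le_lt_trans (lte_add_pinfty Ey Sy).
  apply: (@le_trans _ _ (mu (E `|` S))); last exact: measureU2.
  apply: le_measure; rewrite ?inE//; first exact: measurableU.
  by move=> x [[]|[]]; [left|right].
apply: le_Rintegral => //.
- apply: integrable_norm; by apply: integrable_EFinB => //; exact: ic.
- exact: integrable_indic_fin.
move=> x _; rewrite -mulrBl normrM.
apply: (@le_trans _ _ `|\1_S x - \1_E x|); first by rewrite ler_piMr// norm_cos_le1.
rewrite !indicE /setY in_setU !in_setD.
by case: (x \in E); case: (x \in S); rewrite /= ?subrr ?subr0 ?sub0r ?normrN ?normr0 ?normr1.
Qed.

Lemma gauss_energy_setY eps E S (r : R) : 0 < eps -> measurable E -> (mu E < +oo)%E ->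
  measurable S -> (mu S < +oo)%E -> (mu (setY E S) <= r%:E)%E ->
  (gauss_energy eps S <= 2%:E * gauss_energy eps E + (4 * r ^+ 2 * gauss_weight eps)%:E)%E.
Proof.
move=> e0 mE Ey mS Sy Yr.
have mY : measurable (setY E S) by apply: measurableU; exact: measurableD.
have h th xi : (trig S th xi - trig E th xi) ^+ 2 <= r ^+ 2 * (1 + dot xi xi).
  rewrite -[leLHS]mulr1 ler_pM ?sqr_ge0//; last by rewrite lerDl dot_ge0.
  rewrite -real_normK ?num_real// lerXn2r ?nnegrE//.
    by rewrite -lee_fin; apply: le_trans Yr.
  apply: le_trans (trig_setY _ _ mE Ey mS Sy) _.
  by rewrite -lee_fin fineK// ge0_fin_numE// (le_lt_trans Yr)// ltry.
by apply: gauss_energy_perturb => //; exact: measurable_trig.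
Qed.

Lemma gauss_energy_fill_bound eps delta E S (h : R) : 0 < eps -> 0 < delta ->
  0 < h -> measurable E -> (mu E < +oo)%E -> measurable S -> (mu S < +oo)%E ->
  (forall k, (\int[mu]_(x in grid_cell h k) (\1_S x)%:E =
              \int[mu]_(x in grid_cell h k) (smoothing delta E x)%:E)%E) ->
  (gauss_energy eps S <= 2%:E * gauss_energy delta E +
    (4 * (2 * h * n%:R * fine (mu E)) ^+ 2 * gauss_weight eps)%:E)%E.
Proof.
move=> e0 d0 h0 mE Ey mS Sy fill.
pose A th xi := expR (- (delta ^+ 2 * dot xi xi / 2)) * trig E th xi.
have mA th : measurable_fun setT (A th).
  apply: measurable_funM; last exact: measurable_trig.
  apply: measurableT_comp => //; apply: measurableT_comp => //.
  by apply: measurable_funM => //; apply: measurable_funM => //; exact: measurable_dot.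
have isf := integrable_smoothing d0 mE Ey.
have close th xi : (trig S th xi - A th xi) ^+ 2 <=
    (2 * h * n%:R * fine (mu E)) ^+ 2 * (1 + dot xi xi).
  have S0 x : 0 <= \1_S x :> R by [].
  have := @grid_cos_close R n h h0 _ _ th xi isf (integrable_indic_fin mS Sy)
    (smoothing_ge0 d0 mE) S0 (fun k => esym (fill k)).
  rewrite Rintegral_smoothing_cos// -trig_indic -/(A th xi) => cl.
  have {}cl : `|A th xi - trig S th xi| <= 2 * h * n%:R * fine (mu E) * enorm xi.
    apply: le_trans cl _.
    rewrite {1}/Rintegral integral_smoothing//.
    rewrite [leRHS](_ : _ = 2 * (h * (n%:R * enorm xi)) * fine (mu E)); last by ring.
    rewrite ler_wpM2r ?fine_ge0// ler_wpM2l// ler_wpM2l ?(ltW h0)//.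
    apply: (@le_trans _ _ (\sum_(i < n) enorm xi)).
      by apply: ler_sum => i _; exact: coord_le_enorm.
    by rewrite sumr_const card_ord mulr_natl.
  rewrite -real_normK ?num_real// distrC.
  apply: (@le_trans _ _ ((2 * h * n%:R * fine (mu E) * enorm xi) ^+ 2)).
    rewrite lerXn2r ?nnegrE//.
    by rewrite !mulr_ge0 ?(ltW h0) ?fine_ge0 ?enorm_ge0.
  by rewrite exprMn sqr_enorm ler_wpM2l ?sqr_ge0// lerDr.
apply: le_trans (gauss_energy_perturb e0 mS Sy (mA 0) (mA _) (close 0) (close _)) _.
apply: leeD => //; apply: lee_wpmul2l; first by rewrite lee_fin.
have g0 xi (e a b : R) : 0 <= enorm xi * (expR e * (a ^+ 2 + b ^+ 2)).
  by rewrite mulr_ge0 ?enorm_ge0// mulr_ge0 ?expR_ge0// addr_ge0 ?sqr_ge0.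
apply: ge0_le_integral => //.
- by move=> xi _; rewrite lee_fin g0.
- apply/measurable_EFinP; apply: measurable_funM; first exact: measurable_enorm.
  apply: measurable_funM; first exact: measurable_expRN_dot.
  by apply: measurable_funD; exact: measurable_funX.
- apply/measurable_EFinP; apply: measurable_funM; first exact: measurable_enorm.
  apply: measurable_funM; first exact: measurable_expRN_dot.
  by apply: measurable_funD; apply: measurable_funX; exact: measurable_trig.
move=> xi _; rewrite lee_fin ler_wpM2l ?enorm_ge0//.
rewrite /A !exprMn -mulrDr mulrA ler_wpM2r ?addr_ge0 ?sqr_ge0//.
rewrite [X in _ * X](_ : _ = expR (- (delta ^+ 2 * dot xi xi))); last first.
  by rewrite expr2 -expRD; congr expR; field.
rewrite ler_piMl ?expR_ge0// -expR0 ler_expR oppr_le0.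
by rewrite mulr_ge0 ?sqr_ge0 ?dot_ge0.
Qed.

Lemma low_energy_dense (i0 : 'I_n) E (eta : R) (k : nat) :
  open E -> (mu E < +oo)%E -> 0 < eta ->
  exists S (r eps : R),
    [/\ open S /\ (mu S < +oo)%E, (mu (setY E S) < eta%:E)%E, 0 < r,
        0 < eps < k.+1%:R^-1 &
        forall S', measurable S' -> (mu S' < +oo)%E ->
          (mu (setY S S') <= r%:E)%E ->
          ((`|ln eps|^-1)%:E * gauss_energy eps S' <= (k.+1%:R^-1)%:E)%E].
Proof.
move=> oE Ey eta0; have mE := open_rV_measurable oE.
have [delta d0 dclose] := L1_smoothing_lt oE Ey eta0.
have HdE : gauss_energy delta E \is a fin_num.
  rewrite ge0_fin_numE ?gauss_energy_lty//; apply: integral_ge0 => xi _.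
  by rewrite lee_fin mulr_ge0 ?enorm_ge0// mulr_ge0 ?expR_ge0// addr_ge0 ?sqr_ge0.
(* [M] will bound the energy of S and [B] that of the sets close to S; each factor 2 comes from a
   perturbation estimate and each 1 is its error term. Both are fixed before [eps]. *)
pose M := 2 * fine (gauss_energy delta E) + 1; pose B := 2 * M + 1.
have M0 : 0 <= M.
  rewrite addr_ge0// mulr_ge0// fine_ge0//; apply: integral_ge0 => xi _.
  by rewrite lee_fin mulr_ge0 ?enorm_ge0// mulr_ge0 ?expR_ge0// addr_ge0 ?sqr_ge0.
have B0 : 0 <= B by rewrite addr_ge0// mulr_ge0.
(* With eps = e^(-T), |ln eps| = T makes [B] / |ln eps| at most 1/(k+1), and T >= k+1 makes [eps]
   less than 1/(k+1). *)
pose T := k.+1%:R * (B + 1).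
have k0 : 0 < k.+1%:R :> R by [].
have Tk : k.+1%:R <= T by rewrite ler_peMr// lerDr.
have T0 : 0 < T by exact: lt_le_trans Tk.
pose eps := expR (- T).
have e0 : 0 < eps by exact: expR_gt0.
have lne : `|ln eps| = T by rewrite expRK normrN gtr0_norm.
pose W := gauss_weight eps; have W0 : 0 <= W by exact: gauss_weight_ge0.
(* The error of the grid is h^2 [X], at most 1 for h = 1/(1+X). The radius [r] below is chosen in
   the same way from the error r^2 (4 W). *)
pose X := 4 * (2 * n%:R * fine (mu E)) ^+ 2 * W.
have X0 : 0 <= X by apply: mulr_ge0 => //; rewrite mulr_ge0 ?sqr_ge0.
pose h := (1 + X)^-1.
have h0 : 0 < h by rewrite invr_gt0 ltr_pwDl.
have inv_sqr (y : R) : 0 <= y -> (1 + y)^-1 ^+ 2 * y <= 1.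
  move=> y0; have y1 : 0 < 1 + y by rewrite ltr_pwDl.
  by rewrite exprVn mulrC ler_pdivrMr ?exprn_gt0// mul1r; nra.
have f01 x : 0 <= smoothing delta E x <= 1 by rewrite smoothing_ge0//= smoothing_le1.
have [S [oS Sy YS fill]] := grid_fill i0 h0 oE Ey (integrable_smoothing d0 mE Ey) f01.
have mS := open_rV_measurable oS.
pose r := (1 + 4 * W)^-1.
have r0 : 0 < r by rewrite invr_gt0 ltr_pwDl// mulr_ge0.
have HS : (gauss_energy eps S <= M%:E)%E.
  apply: le_trans (gauss_energy_fill_bound e0 d0 h0 mE Ey mS Sy fill) _.
  rewrite -(fineK HdE) -EFinM -EFinD lee_fin lerD2l -/W.
  have -> : 4 * (2 * h * n%:R * fine (mu E)) ^+ 2 * W = h ^+ 2 * X by rewrite /X; ring.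
  exact: inv_sqr.
exists S, r, eps; split => //.
- exact: le_lt_trans dclose.
- rewrite e0/= /eps expRN ltf_pV2 ?posrE ?expR_gt0//.
  by apply: le_lt_trans Tk _; apply: lt_le_trans (expR_ge1Dx _); rewrite ltrDr.
move=> S' mS' S'y Yr.
have HS' : (gauss_energy eps S' <= B%:E)%E.
  apply: le_trans (gauss_energy_setY e0 mS Sy mS' S'y Yr) _.
  have -> : (B%:E = 2%:E * M%:E + 1%:E)%E by rewrite /B EFinD EFinM.
  apply: leeD.
    by apply: lee_wpmul2l => //; rewrite lee_fin.
  rewrite lee_fin -/W (_ : _ * W = r ^+ 2 * (4 * W)); last by ring.
  by apply: inv_sqr; rewrite mulr_ge0.
apply: (@le_trans _ _ ((`|ln eps|^-1)%:E * B%:E)%E).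
  by apply: lee_wpmul2l => //; rewrite lee_fin invr_ge0.
rewrite -EFinM lee_fin lne /T invfM -mulrA ler_piMr ?invr_ge0 ?(ltW k0)//.
by rewrite mulrC ler_pdivrMr ?ltr_wpDl// mul1r lerDl.
Qed.

End energy.

(** * Sets of large perimeter *)

Section bump.
Context {R : realType}.
Notation leb := (@lebesgue_measure R).

(** Composition with this projection onto [0, L] extends by zero a function that vanishes at both
    ends. *)
Definition clamp (L t : R) : R := Num.max 0 (Num.min t L).

Lemma clamp_id (L t : R) : 0 <= t <= L -> clamp L t = t.
Proof. by move=> /andP[t0 tL]; rewrite /clamp min_l// max_r. Qed.

Lemma clamp_lt0 (L t : R) : 0 <= L -> t <= 0 -> clamp L t = 0.
Proof. by move=> L0 t0; rewrite /clamp max_l// ge_min t0. Qed.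

Lemma clamp_gt (L t : R) : 0 <= L -> L <= t -> clamp L t = L.
Proof. by move=> L0 Lt; rewrite /clamp min_r// max_r. Qed.

Lemma continuous_clamp (L : R) : continuous (clamp L).
Proof.
move=> t; apply: (@continuous_max R R (cst 0) (fun t => Num.min t L) t).
  exact: cst_continuous.
apply: (@continuous_min R R id (cst L) t); last exact: cst_continuous.
exact: cvg_id.
Qed.

Section cut.
Variables (f f' : R -> R) (L : R).
Hypotheses (L0 : 0 <= L) (f0 : f 0 = 0) (fL : f L = 0) (f'0 : f' 0 = 0) (f'L : f' L = 0).
Hypothesis df : forall t : R, is_derive t (1 : R) f (f' t).

Let cut_le t : `|f (clamp L t)| <= `|f t|.
Proof.
have [t0|t0] := leP t 0; first by rewrite clamp_lt0// f0 normr0.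
have [tL|tL] := leP L t; first by rewrite clamp_gt// fL normr0.
by rewrite clamp_id// ?(ltW t0) ?(ltW tL).
Qed.

(** At the ends, [cut_le] bounds the difference quotient of the extension by that of f, which tends
    to 0 because f' vanishes there. *)
Lemma is_derive_cut (t : R) :
  is_derive t (1 : R) (f \o clamp L) (f' (clamp L t)).
Proof.
have dft (s : R) : h^-1 *: (f (h *: 1 + s) - f s) @[h --> 0^'] --> f' s.
  by have [d1 <-] := df s; exact: d1.
suff H : h^-1 *: ((f \o clamp L) (h *: 1 + t) - (f \o clamp L) t) @[h --> 0^'] -->
    f' (clamp L t).
  split; first by apply/cvg_ex; exists (f' (clamp L t)).
  by apply: cvg_lim H.
have near_h (e : R) : 0 < e -> \forall h \near (0 : R)^', - e < h < e.
  move=> e0; apply: filterS (dnbhs0_lt e0) => h.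
  by rewrite ltr_norml.
have zero : f (clamp L t) = 0 -> f' (clamp L t) = 0 ->
    (\forall h \near (0 : R)^', f (clamp L (h + t)) = 0) ->
    h^-1 *: ((f \o clamp L) (h *: 1 + t) - (f \o clamp L) t) @[h --> 0^'] --> f' (clamp L t).
  move=> ft f't h0; rewrite f't; apply: cvg_near_cst.
  by apply: filterS h0 => h /=; rewrite scaler1 ft => ->; rewrite subrr scaler0.
have edge : f t = 0 -> f' t = 0 -> clamp L t = t ->
    h^-1 *: ((f \o clamp L) (h *: 1 + t) - (f \o clamp L) t) @[h --> 0^'] --> f' (clamp L t).
  move=> ft f't ct; rewrite ct f't; apply: norm_cvg0.
  have H : `|h^-1 *: (f (h *: 1 + t) - f t)| @[h --> (0 : R)^'] --> (0 : R).
    suff : `|h^-1 *: (f (h *: 1 + t) - f t)| @[h --> (0 : R)^'] --> `|f' t|.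
      by rewrite f't normr0.
    by apply: cvg_norm; exact: dft.
  apply: (squeeze_cvgr _ (cvg_cst 0) H); apply: nearW => h.
  rewrite normr_ge0/= ct ft !subr0 !normrZ ler_wpM2l//.
have [t0|t0|t0] := ltgtP t 0.
- apply: zero; rewrite ?clamp_lt0 ?(ltW t0)//.
  have t0' : 0 < - t by rewrite oppr_gt0.
  apply: filterS (near_h _ t0') => h /andP[_ h1].
  by rewrite clamp_lt0//; lra.
- have [tL|tL|tL] := ltgtP t L.
  + rewrite clamp_id ?(ltW t0) ?(ltW tL)//.
    apply: cvg_trans (dft t); apply: near_eq_cvg.
    have tL' : 0 < L - t by rewrite subr_gt0.
    near=> h; have h1 : - t < h < t by near: h; exact: near_h.
    have h2 : - (L - t) < h < L - t by near: h; exact: near_h.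
    case/andP: h1 => h1 _; case/andP: h2 => _ h2.
    rewrite /= scaler1 !clamp_id//; apply/andP; split; lra.
  + apply: zero; rewrite ?clamp_gt ?(ltW tL)//.
    have tL' : 0 < t - L by rewrite subr_gt0.
    apply: filterS (near_h _ tL') => h /andP[h1 _].
    by rewrite clamp_gt//; lra.
  + by apply: edge; rewrite ?tL// clamp_gt.
- by apply: edge; rewrite t0// clamp_lt0.
Unshelve. all: by end_near. Qed.

Lemma cut_outside t : ~~ (0 <= t <= L) -> f (clamp L t) = 0 /\ f' (clamp L t) = 0.
Proof.
rewrite negb_and -!ltNge => /orP[t0|tL].
  by rewrite clamp_lt0// ltW.
by rewrite clamp_gt// ltW.
Qed.

End cut.

Section sine_bump.
Variables (L : R) (m : nat).
Hypothesis L0 : 0 < L.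
Hypothesis m0 : (0 < m)%N.

(** With this frequency sin^2 has exactly [m] humps on [0, L], and both it and its derivative vanish
    at the ends. *)
Definition freq : R := pi * m%:R / L.
Definition wave (t : R) : R := sin (freq * t) ^+ 2.
Definition wave' (t : R) : R := freq * sin (freq * t *+ 2).

Lemma freq_gt0 : 0 < freq.
Proof. by rewrite divr_gt0// mulr_gt0 ?pi_gt0// ltr0n. Qed.

Lemma sin_natpi (k : nat) : sin (pi * k%:R) = 0 :> R.
Proof.
elim: k => [|k ih]; first by rewrite mulr0 sin0.
by rewrite -natr1 mulrDr mulr1 sinD ih mul0r sinpi mulr0 addr0.
Qed.

Lemma freqL : freq * L = pi * m%:R.
Proof. by rewrite /freq divfK// gt_eqF. Qed.

Lemma wave0 : wave 0 = 0.
Proof. by rewrite /wave mulr0 sin0 expr0n. Qed.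

Lemma waveL : wave L = 0.
Proof. by rewrite /wave freqL sin_natpi expr0n. Qed.

Lemma wave'0 : wave' 0 = 0.
Proof. by rewrite /wave' mulr0 mul0rn sin0 mulr0. Qed.

Lemma wave'L : wave' L = 0.
Proof. by rewrite /wave' freqL -mulrnAr -mulrnA sin_natpi mulr0. Qed.

Lemma is_derive_wave (t : R) : is_derive t (1 : R) wave (wave' t).
Proof.
rewrite /wave; apply: is_derive_eq; rewrite /GRing.scale/= /wave' mulr2n sinD; ring.
Qed.

Lemma wave_ge0 t : 0 <= wave t. Proof. exact: sqr_ge0. Qed.

Lemma wave_le1 t : wave t <= 1.
Proof. by rewrite /wave; have := cos2Dsin2 (freq * t); have := sqr_ge0 (cos (freq * t)); lra. Qed.

Lemma wave'_bound t : `|wave' t| <= freq.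
Proof.
rewrite /wave' normrM gtr0_norm ?freq_gt0// ler_piMr ?(ltW freq_gt0)//.
by rewrite ler_norml sin_geN1 sin_le1.
Qed.

Lemma continuous_sin_lin (c : R) : continuous (fun t : R => sin (c * t)).
Proof.
move=> t; apply: continuous_comp; last exact: continuous_sin.
by apply: cvgMr; exact: cvg_id.
Qed.

Lemma continuous_wave : continuous wave.
Proof. by move=> t; apply: cvgM; exact: continuous_sin_lin. Qed.

Lemma continuous_wave' : continuous wave'.
Proof.
rewrite (_ : wave' = fun t => freq * sin (freq *+ 2 * t)).
  by move=> t; apply: cvgMr; exact: continuous_sin_lin.
by apply/funext => t; rewrite /wave'; congr (_ * sin _); ring.
Qed.

Lemma integral_clamp (f : R -> R) : f 0 = 0 -> f L = 0 ->
  (\int[leb]_t (f (clamp L t))%:E = \int[leb]_(t in `[0%R, L]) (f t)%:E)%E.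
Proof.
move=> f0 fL; rewrite [RHS]integral_mkcond; apply: eq_integral => t _.
rewrite patchE; case: ifPn => [|].
  by rewrite inE/= in_itv/= => tL; rewrite clamp_id.
rewrite notin_setE/= in_itv/= => /negP.
rewrite negb_and -!ltNge => /orP[h|h].
  by rewrite clamp_lt0 ?f0// ltW.
by rewrite clamp_gt ?fL// ltW.
Qed.

Lemma FTC_continuous (f F : R -> R) : continuous f ->
  (forall t : R, is_derive t (1 : R) F (f t)) ->
  (\int[leb]_(t in `[0%R, L]) (f t)%:E = (F L - F 0)%:E)%E.
Proof.
move=> cf dF; rewrite (@continuous_FTC2 _ f F)//.
- exact: continuous_subspaceT.
- have dd (x : R) : derivable F x 1 by have [] := dF x.
  have cF (x : R) : {for x, continuous F}.
    by apply: differentiable_continuous; exact/derivable1_diffP.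
  split => //; [exact: cvg_at_right_filter (cF _)|exact: cvg_at_left_filter (cF _)].
- by move=> x _; rewrite derive1E; have [] := dF x.
Qed.

Lemma integral_wave : (\int[leb]_t (wave (clamp L t))%:E = (L / 2)%:E)%E.
Proof.
rewrite (integral_clamp wave0 waveL).
pose F (t : R) := t / 2 - sin (freq *+ 2 * t) / (4 * freq).
have f0 := freq_gt0.
have dF (t : R) : is_derive t (1 : R) F (wave t).
  rewrite /F; apply: is_derive_eq.
  rewrite /GRing.scale/= /wave.
  have -> : freq *+ 2 * t = freq * t + freq * t by ring.
  rewrite cosD.
  have := cos2Dsin2 (freq * t) => h.
  have -> : cos (freq * t) * cos (freq * t) = 1 - sin (freq * t) ^+ 2 by rewrite -h; ring.
  by field; rewrite gt_eqF.
rewrite (FTC_continuous continuous_wave dF) /F mulr0 sin0.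
have -> : freq *+ 2 * L = pi * (m * 2)%:R by rewrite natrM mulrA -freqL; ring.
rewrite sin_natpi.
by congr EFin; field; rewrite gt_eqF.
Qed.

(** The exact value is [m], the total rise over the humps. A bound linear in [m] and independent of
    [L] is what matters, and minorizing the positive part by a trigonometric polynomial gives it
    through an explicit primitive. *)
Lemma integral_wave'_pos :
  ((pi * m%:R / 4)%:E <= \int[leb]_t (Num.max (wave' (clamp L t)) 0)%:E)%E.
Proof.
have f0 := freq_gt0.
have cm : continuous (fun t => Num.max (wave' t) 0).
  move=> t; apply: (@continuous_max R R wave' (cst 0) t); last exact: cst_continuous.
  exact: continuous_wave'.
rewrite (@integral_clamp (fun t => Num.max (wave' t) 0)) ?wave'0 ?wave'L ?maxxx//.
(* On [-1, 1], max(s, 0) >= (s^2 + s) / 2. *)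
pose g (t : R) := freq / 2 * (sin (freq *+ 2 * t) ^+ 2 + sin (freq *+ 2 * t)).
pose F (t : R) := freq / 4 * t - sin (freq *+ 4 * t) / 16 - cos (freq *+ 2 * t) / 4.
have cg : continuous g.
  move=> t; apply: cvgMr; apply: cvgD; last exact: continuous_sin_lin.
  by apply: cvgM; exact: continuous_sin_lin.
have dF (t : R) : is_derive t (1 : R) F (g t).
  rewrite /F; apply: is_derive_eq; rewrite /GRing.scale/= /g.
  have -> : freq *+ 4 * t = freq *+ 2 * t + freq *+ 2 * t by ring.
  rewrite cosD; set c := cos _; set s := sin (freq *+ 2 * t).
  have h : c ^+ 2 + s ^+ 2 = 1 by exact: cos2Dsin2.
  have -> : c * c = 1 - s ^+ 2 by rewrite -h; ring.
  by field.
rewrite [leLHS](_ : _ = \int[leb]_(t in `[0%R, L]) (g t)%:E)%E; last first.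
  rewrite (FTC_continuous cg dF) /F !mulr0 sin0 cos0.
  have -> : freq *+ 4 * L = pi * (m * 4)%:R by rewrite natrM mulrA -freqL; ring.
  have -> : freq *+ 2 * L = pi * m%:R + pi * m%:R by rewrite -freqL; ring.
  rewrite sin_natpi cosD.
  have := cos2Dsin2 (pi * m%:R : R); rewrite sin_natpi expr0n/= addr0 expr2 => ->.
  by rewrite mul0r; congr EFin; rewrite -freqL; field.
have ic (f : R -> R) : continuous f -> leb.-integrable `[0, L] (EFin \o f).
  move=> cf; apply: continuous_compact_integrable; first exact: segment_compact.
  exact: continuous_subspaceT.
apply: le_integral => //; [exact: ic|exact: ic|].
move=> t _; rewrite lee_fin le_max /g /wave'.
have -> : freq * t *+ 2 = freq *+ 2 * t by ring.
set s := sin _; have s1 : - 1 <= s <= 1 by rewrite sin_geN1 sin_le1.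
have [sp|sn] := leP 0 s.
  apply/orP; left; rewrite -mulrA ler_wpM2l ?(ltW f0)//; nra.
apply/orP; right; rewrite pmulr_rle0 ?divr_gt0//.
have -> : s ^+ 2 + s = - (- s * (1 + s)) by ring.
  by rewrite oppr_le0 mulr_ge0//; lra.
by rewrite mulr_gt0 ?pi_gt0// ltr0n.
Qed.

End sine_bump.

End bump.

(** * Adding perimeter inside a thin box *)

Section perimeter_density.
Context {R : realType} {n : nat}.
Variable i0 : 'I_n.
Local Notation mu := (@lebesgue_rV R n).
Local Notation leb := (@lebesgue_measure R).
Implicit Types (x y : 'rV[R]_n) (E S : set 'rV[R]_n).

Section product_derivative.
Variables (s s' : 'I_n -> R -> R).
Hypothesis ds : forall i (t : R), is_derive t (1 : R) (s i) (s' i t).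

Lemma is_derive_prod_coord j x :
  is_derive x (delta_mx ord0 j) (fun y : 'rV[R]_n => \prod_i s i (y ord0 i))
    (s' j (x ord0 j) * \prod_(i < n | i != j) s i (x ord0 i)).
Proof.
pose P := \prod_(i < n | i != j) s i (x ord0 i).
pose f y := \prod_i s i (y ord0 i).
have fE (h : R) : f (h *: delta_mx ord0 j + x) = s j (h *: 1 + x ord0 j) * P.
  rewrite /f (bigD1 j)//= !mxE !eqxx/=; congr (_ * _).
  by apply: eq_bigr => i /negbTE ij; rewrite !mxE ij andbF mulr0 add0r.
have f0 : f x = s j (x ord0 j) * P by rewrite /f (bigD1 j).
have H : h^-1 *: (f (h *: delta_mx ord0 j + x) - f x) @[h --> (0 : R)^'] --> s' j (x ord0 j) * P.
  rewrite (_ : (fun h => _) = fun h : R => h^-1 *: (s j (h *: 1 + x ord0 j) - s j (x ord0 j)) * P).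
    apply: cvgMl; have [d1 <-] := ds j (x ord0 j); exact: d1.
  by apply/funext => h; rewrite fE f0 -mulrBl /GRing.scale/= mulrA.
split; first by apply/cvg_ex; exists (s' j (x ord0 j) * P).
by apply: cvg_lim H.
Qed.

End product_derivative.

(** Each functional in the supremum defining the perimeter is Lipschitz for the measure of the
    symmetric difference; hence lower bounds of the perimeter are stable. *)
Lemma Rintegral_setY_ge (D : 'rV[R]_n -> R) (M : R) E S :
  measurable_fun setT D -> (forall x, `|D x| <= M) ->
  measurable E -> (mu E < +oo)%E -> measurable S -> (mu S < +oo)%E ->
  \int[mu]_(x in E) D x - M * fine (mu (setY E S)) <= \int[mu]_(x in S) D x.
Proof.
move=> mD DM mE Ey mS Sy.
have iD A : measurable A -> (mu A < +oo)%E -> mu.-integrable setT (EFin \o (D \_ A)).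
  move=> mA Ay; have iA := integrable_bounded_on mA Ay mD DM.
  by have /integrable_mkcond := iA => /(_ mA); rewrite restrict_EFin.
have mY : measurable (setY E S) by apply: measurableU; exact: measurableD.
have Yy : (mu (setY E S) < +oo)%E.
  apply: le_lt_trans (lte_add_pinfty Ey Sy).
  apply: (@le_trans _ _ (mu (E `|` S))); last exact: measureU2.
  apply: le_measure; rewrite ?inE//; first exact: measurableU.
  by move=> x [[]|[]]; [left|right].
have i1 := integrable_EFinZl measurableT M (integrable_indic_fin mY Yy).
have -> : M * fine (mu (setY E S)) = \int[mu]_x (M * \1_(setY E S) x).
  rewrite RintegralZl//; last exact: integrable_indic_fin.
  by rewrite /Rintegral integral_indic// setIT.
rewrite (Rintegral_mkcond mu E D) (Rintegral_mkcond mu S D) -RintegralB//; last exact: iD.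
apply: le_Rintegral => //; [|exact: iD|].
  by apply: integrable_EFinB => //; exact: iD.
move=> x _; rewrite !patchE indicE /setY in_setU !in_setD.
have := DM x; rewrite ler_norml => /andP[a b].
rewrite (_ : point = 0 :> R)//.
by case: (x \in E); case: (x \in S); rewrite /= ?mulr1 ?mulr0; lra.
Qed.

(** The box has volume [a]. It is thin and carries many humps in the direction [i0]; in the others a
    single hump serves as a cutoff. *)
Let side (a : R) (i : 'I_n) : R := if i == i0 then a else 1.
Let humps (N : nat) (i : 'I_n) : nat := if i == i0 then N else 1%N.

(** The only nonzero component, along [i0], is a product of one-dimensional bumps, which is C^1
    across the faces of the box. The direction [i0] contributes pi N / 4 and each of the n - 1
    others 1/2; the bound does not depend on [a], so the box may be as thin as desired. The exponent
    n in place of n - 1 only weakens it. *)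
Lemma striped_field (a : R) (N : nat) : 0 < a -> (0 < N)%N ->
  exists (phi : 'rV[R]_n -> 'rV[R]_n) (M : R),
  [/\ C1c_field phi, forall x, enorm (phi x) <= 1,
      continuous (divergence phi), forall x, `|divergence phi x| <= M &
      (forall x, ~ rV_box (fun i => `[0, side a i]%classic) x -> divergence phi x = 0) /\
      ((pi * N%:R / 4 * 2^-1 ^+ n)%:E <=
        \int[mu]_x (Num.max (divergence phi x) 0)%:E)%E].
Proof.
move=> a0 N0.
have L0 i : 0 < side a i by rewrite /side; case: ifP.
have m0 i : (0 < humps N i)%N by rewrite /humps; case: ifP.
pose s i := wave (side a i) (humps N i) \o clamp (side a i).
pose s' i := wave' (side a i) (humps N i) \o clamp (side a i).
have ds i (t : R) : is_derive t (1 : R) (s i) (s' i t).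
  apply: is_derive_cut; rewrite ?wave0 ?(waveL _ (L0 i)) ?wave'0 ?(wave'L _ (L0 i)) ?ltW//.
  by move=> u; exact: is_derive_wave.
have cs i : continuous (s i).
  by move=> t; apply: continuous_comp; [exact: continuous_clamp|exact: continuous_wave].
have cs' i : continuous (s' i).
  by move=> t; apply: continuous_comp; [exact: continuous_clamp|exact: continuous_wave'].
have s01 i t : 0 <= s i t <= 1 by rewrite /s /= wave_ge0 wave_le1.
have ccomp (g : 'I_n -> R -> R) : (forall i, continuous (g i)) ->
    forall i, continuous (fun x : 'rV[R]_n => g i (x ord0 i)).
  move=> cg i x; apply: (@continuous_comp _ _ _ (fun x : 'rV[R]_n => x ord0 i) (g i)).
    exact: coord_continuous.
  exact: cg.
pose psi x := \prod_i s i (x ord0 i).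
pose D j x := s' j (x ord0 j) * \prod_(i < n | i != j) s i (x ord0 i).
have dpsi j x : is_derive x (delta_mx ord0 j) psi (D j x) by exact: is_derive_prod_coord.
have pD j : partial j psi = D j by apply/funext => x; have [_] := dpsi j x.
have cpsi : continuous psi by apply: continuous_bigprod; exact: ccomp.
have cD j : continuous (D j).
  move=> x; apply: (@continuousM _ _ (fun x : 'rV[R]_n => s' j (x ord0 j))
     (fun x : 'rV[R]_n => \prod_(i < n | i != j) s i (x ord0 i)) x).
    exact: (ccomp s' cs' j).
  by apply: continuous_bigprod; exact: ccomp.
pose phi x : 'rV[R]_n := \row_i (if i == i0 then psi x else 0).
have phiE i : (fun x => phi x ord0 i) = if i == i0 then psi else cst 0.
  by apply/funext => x; rewrite mxE; case: ifP.
have divE : divergence phi = D i0.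
  apply/funext => x; rewrite /divergence (bigD1 i0)//= big1 ?addr0.
    by rewrite phiE eqxx pD.
  by move=> i /negbTE ii0; rewrite phiE ii0 /partial derive_cst.
have psi01 x : 0 <= psi x <= 1.
  rewrite prodr_ge0 => [|i _]; last by case/andP: (s01 i (x ord0 i)).
  by apply: prodr_ile1 => i _; exact: s01.
have zero_box x : ~ rV_box (fun i => `[0, side a i]%classic) x ->
    psi x = 0 /\ D i0 x = 0.
  move=> nb; have [i hi] : exists i, ~~ (0 <= x ord0 i <= side a i).
    apply: contrapT => h; apply: nb => i; rewrite /= in_itv/=.
    by apply: contrapT => /negP hi; apply: h; exists i.
  have [si s'i] : s i (x ord0 i) = 0 /\ s' i (x ord0 i) = 0.
    apply: cut_outside hi; rewrite ?wave0 ?(waveL _ (L0 i)) ?wave'0 ?(wave'L _ (L0 i)) ?ltW//.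
  split; first by rewrite /psi (bigD1 i)//= si mul0r.
  rewrite /D; have [->|ii0] := eqVneq i0 i; first by rewrite s'i mul0r.
  by rewrite (bigD1 i)//= ?si ?mul0r ?mulr0// eq_sym.
exists phi, (freq (side a i0) (humps N i0)); rewrite divE; split.
- split.
    move=> i; rewrite phiE; case: eqP => _.
      split => // j; split; last by rewrite pD; split => //; exact: cD.
      by move=> x; have [] := dpsi j x.
    split; first exact: cst_continuous.
    move=> j; split; first by move=> x; exact: derivable_cst.
    rewrite (_ : partial j _ = cst 0); last by apply/funext => x; rewrite /partial derive_cst.
    by split => //; exact: cst_continuous.
  apply: (@subclosed_compact _ (tsupport phi)
     (rV_box (fun i => `[0, side a i]%classic))).
  + exact: closed_closure.
  + by apply: rV_compact => i; exact: segment_compact.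
  + rewrite [X in _ `<=` X](closure_id _).1; last first.
      by apply: closed_rV_box => i; exact: interval_closed.
    apply: closure_subset => x /= px; apply: contrapT => /zero_box[px0 _].
    move/eqP : px; apply; apply/rowP => i; rewrite !mxE px0.
    by case: ifP.
- move=> x; rewrite /enorm /dot (bigD1 i0)//= big1 => [|i /negbTE ii0].
    rewrite !mxE eqxx addr0 -expr2 sqrtr_sqr.
    by case/andP: (psi01 x) => h0 h1; rewrite ger0_norm.
  by rewrite !mxE ii0 mulr0.
- exact: cD.
- move=> x; rewrite /D normrM.
  apply: le_trans (wave'_bound (L0 i0) (m0 i0) (clamp (side a i0) (x ord0 i0))).
  rewrite ler_piMr// ger0_norm.
    by apply: prodr_ile1 => i _; exact: s01.
  by apply: prodr_ge0 => i _; case/andP: (s01 i (x ord0 i)).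
- split; first by move=> x /zero_box[].
  (* The other factors are nonnegative, so the positive part of the divergence is again a product of
     functions of one coordinate. *)
  pose r i t := if i == i0 then Num.max (s' i t) 0 else s i t.
  have r0 i t : 0 <= r i t.
    rewrite /r; case: ifP => _; first by rewrite le_max lexx orbT.
    by case/andP: (s01 i t).
  have mr i : measurable_fun setT (r i).
    have [ii0|ii0] := eqVneq i i0; rewrite /r ?ii0 ?eqxx ?(negbTE ii0); last first.
      by apply: continuous_measurable_fun; exact: cs.
    by apply: measurable_maxr => //; apply: continuous_measurable_fun; exact: cs'.
  rewrite [leRHS](_ : _ = \int[mu]_x (\prod_i r i (x ord0 i))%:E)%E; last first.
    apply: eq_integral => x _; rewrite (bigD1 i0)//= {1}/r eqxx /D; congr EFin.
    rewrite [in RHS](eq_bigr (fun i => s i (x ord0 i))); last first.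
      by move=> i /negbTE ii0; rewrite /r ii0.
    have P0 : 0 <= \prod_(i < n | i != i0) s i (x ord0 i).
      by apply: prodr_ge0 => i _; case/andP: (s01 i (x ord0 i)).
    by rewrite maxr_pMl// mul0r.
  rewrite ge0_integral_rV_prod// (bigD1 i0)//=.
  have -> : (\prod_(i < n | i != i0) \int[leb]_t (r i t)%:E = (\prod_(i < n | i != i0) 2^-1)%:E)%E.
    rewrite -prodEFin; apply: eq_bigr => i /negbTE ii0.
    rewrite /r ii0 /s /=.
    have := @integral_wave R (side a i) (humps N i) (L0 i) (m0 i).
    by rewrite {3}/side ii0 mul1r.
  have -> : (\int[leb]_t (r i0 t)%:E = \int[leb]_t (Num.max (s' i0 t) 0)%:E)%E.
    by apply: eq_integral => t _; rewrite /r eqxx.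
  have := @integral_wave'_pos R (side a i0) (humps N i0) (L0 i0) (m0 i0).
  rewrite {1}/humps eqxx => le1.
  have le2 : (2^-1 ^+ n <= \prod_(i < n | i != i0) 2^-1 :> R).
    rewrite -[X in _ ^+ X]card_ord -prodr_const (bigD1 i0)//= ler_piMl//.
      by apply: prodr_ge0 => i _; rewrite invr_ge0.
    by lra.
  rewrite EFinM; apply: (@le_trans _ _ ((pi * N%:R / 4)%:E * (\prod_(i < n | i != i0) 2^-1)%:E)%E).
    apply: lee_wpmul2l; last by rewrite lee_fin.
    by rewrite lee_fin divr_ge0// mulr_ge0// pi_ge0.
  by apply: lee_wpmul2r => //; rewrite lee_fin prodr_ge0// => i _; rewrite invr_ge0.
Qed.

Lemma perimeter_ge (phi : 'rV[R]_n -> 'rV[R]_n) (M c : R) E :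
  C1c_field phi -> (forall x, enorm (phi x) <= 1) ->
  continuous (divergence phi) -> (forall x, `|divergence phi x| <= M) ->
  measurable E -> (mu E < +oo)%E ->
  c <= \int[mu]_(x in E) divergence phi x -> (c%:E <= perimeter E)%E.
Proof.
move=> Cphi phi1 cD DM mE Ey ch.
apply: (@le_trans _ _ (\int[mu]_(x in E) (divergence phi x)%:E)%E); last first.
  by apply: ereal_sup_ubound; exists phi.
have iD := integrable_bounded_on mE Ey (continuous_rV_measurable cD) DM.
by rewrite -(fineK (integrable_fin_num mE iD)) lee_fin.
Qed.

Lemma perimeter_dense E (eta : R) (k : nat) :
  open E -> (mu E < +oo)%E -> 0 < eta ->
  exists S (r : R),
    [/\ open S /\ (mu S < +oo)%E, (mu (setY E S) < eta%:E)%E, 0 < r &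
        forall S', measurable S' -> (mu S' < +oo)%E ->
          (mu (setY S S') <= r%:E)%E -> ((k%:R : R)%:E <= perimeter S')%E].
Proof.
move=> oE Ey eta0.
pose a := eta / 2; have a0 : 0 < a by rewrite divr_gt0.
pose c : R := pi / 4 * 2^-1 ^+ n.
have c0 : 0 < c by rewrite mulr_gt0 ?divr_gt0 ?pi_gt0// exprn_gt0.
(* Enough humps for k + 1; the spare 1 is spent on the perturbation of S. *)
pose N := (Num.truncn (k.+1%:R / c)).+1.
have cN : k.+1%:R <= pi * N%:R / 4 * 2^-1 ^+ n :> R.
  rewrite (_ : _ * _ = c * N%:R); last by rewrite /c; ring.
  by rewrite mulrC -ler_pdivrMr// ltW// truncnS_gt.
have [phi [M [Cphi phi1 cD DM [Dout Dint]]]] := striped_field a0 (ltn0Sn _ : (0 < N)%N).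
set D := divergence phi in cD DM Dout Dint *.
set B := rV_box _ in Dout.
have mD : measurable_fun setT D := continuous_rV_measurable cD.
have cB : closed B by apply: closed_rV_box => i; exact: interval_closed.
have mB : measurable B by apply: measurable_rV_box => i; exact: measurable_itv.
have muB : mu B = a%:E.
  rewrite lebesgue_rV_box; last by move=> i; exact: measurable_itv.
  rewrite (bigD1 i0)//= big1 => [|i /negbTE ii0].
    by rewrite mule1 lebesgue_measure_itv/= /side eqxx lte_fin a0 sube0.
  by rewrite lebesgue_measure_itv/= /side ii0 lte_fin ltr01 sube0.
have By : (mu B < +oo)%E by rewrite muB ltry.
pose P := [set x | 0 < D x].
have oP : open P.
  by apply: (@open_comp _ _ D [set y | 0 < y]); [move=> x _; exact: cD|exact: open_gt].
have PB : P `<=` B.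
  by move=> x Px; apply: contrapT => /Dout D0; move: Px; rewrite /P/= D0 ltxx.
(* The box is closed and [P] is open, so [S] is open. The divergence vanishes off the box, so its
   integral over [S] is that of its positive part. *)
pose S := (E `&` ~` B) `|` P.
have oS : open S.
  by apply: openU => //; apply: openI => //; exact: closed_openC.
have mE := open_rV_measurable oE.
have mS := open_rV_measurable oS.
have Sy : (mu S < +oo)%E.
  have mEB : measurable (E `|` B) by exact: measurableU.
  apply: (@le_lt_trans _ _ (mu (E `|` B))).
    by apply: le_measure; rewrite ?inE// => x [[]|/PB]; [left|right].
  apply: le_lt_trans (measureU2 _ _ _) _ => //.
  exact: lte_add_pinfty Ey By.
have mY : measurable (setY E S) by apply: measurableU; exact: measurableD.
(* This radius limits the loss [M] times the symmetric difference to at most 1. *)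
exists S, (1 + `|M|)^-1; split => //.
- apply: (@le_lt_trans _ _ (mu B)).
    apply: le_measure; rewrite ?inE// => x [[Ex nS]|[[[Ex _]|/PB//] nE]] //.
    by apply: contrapT => nB; apply: nS; left.
  suff : (mu B < eta%:E)%E by [].
  by rewrite muB lte_fin /a; lra.
move=> S' mS' S'y Yr; apply: (perimeter_ge Cphi phi1 cD DM) => //.
apply: le_trans (Rintegral_setY_ge mD DM mS Sy mS' S'y).
have SD : k.+1%:R <= \int[mu]_(x in S) D x.
  have iD := integrable_bounded_on mS Sy mD DM.
  rewrite -lee_fin (fineK (integrable_fin_num mS iD)).
  apply: (@le_trans _ _ (pi * N%:R / 4 * 2^-1 ^+ n)%:E); first by rewrite lee_fin.
  apply: le_trans Dint _; rewrite [leRHS]integral_mkcond.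
  rewrite le_eqVlt; apply/orP; left; apply/eqP; apply: eq_integral => x _.
  rewrite patchE; case: ifPn => [|].
    move=> /set_mem[[_ /Dout D0]|Px]; first by rewrite /= D0 maxxx.
    by rewrite max_l// ltW.
  rewrite notin_setE => nS; rewrite max_r// leNgt; apply/negP => Px.
  by apply: nS; right.
apply: le_trans (lerB SD _ : k.+1%:R - 1 <= _); first by rewrite -natr1 addrK.
have YfE : mu (setY S S') \is a fin_num by rewrite ge0_fin_numE//; apply: le_lt_trans Yr (ltry _).
have Yf : fine (mu (setY S S')) <= (1 + `|M|)^-1 by rewrite -lee_fin fineK.
apply: (@le_trans _ _ (`|M| * (1 + `|M|)^-1)).
  apply: le_trans (ler_wpM2r (fine_ge0 (measure_ge0 _ _)) (ler_norm M)) _.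
  by rewrite ler_wpM2l.
by rewrite ler_pdivrMr ?ltr_pwDl// mul1r lerDr.
Qed.

End perimeter_density.

(** * The category argument *)

Section stable_dense.
Context d (T : measurableType d) (R : realType) (mu : {measure set T -> \bar R}).
Implicit Types (E S : set T) (C : set (set T)).

(** A point whose membership never changes from the index m on belongs to the lower limit exactly if
    it belongs to [F m]. *)
Lemma setY_bigcup_liminf (F : nat -> set T) (m : nat) :
  setY (F m) (\bigcup_N \bigcap_(j in [set j | N <= j]%N) F j) `<=`
  \bigcup_j setY (F (m + j)%N) (F (m + j).+1).
Proof.
move=> x Yx; apply: contrapT => nY.
have step j : F (m + j)%N x <-> F (m + j).+1 x.
  split=> Fx; apply: contrapT => nFx; apply: nY; exists j => //; [by left|by right].
have all j : F m x <-> F (m + j)%N x.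
  elim: j => [|j ih]; first by rewrite addn0.
  by rewrite addnS; apply: (iff_trans ih); exact: step.
case: Yx => -[h1 h2].
  apply: h2; exists m => // j /= mj; rewrite -(subnKC mj); exact/all.
apply: h2; case: h1 => N _ /(_ (m + N)%N) h; apply/(all N); apply: h => /=.
exact: leq_addl.
Qed.

(** Baire's argument with the limit made explicit: the sets form a sequence with summable distances,
    and their lower limit is the limit in measure. It may leave [C], which is why the stability
    hypothesis concerns every measurable set of finite measure. *)
Lemma stable_dense_inhabited C (P : nat -> set T -> Prop) S0 :
  C S0 -> (forall S, C S -> measurable S /\ (mu S < +oo)%E) ->
  (forall k E (eta : R), C E -> 0 < eta ->
    exists S (r : R), [/\ C S, (mu (setY E S) < eta%:E)%E, 0 < r &
      forall S', measurable S' -> (mu S' < +oo)%E ->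
        (mu (setY S S') <= r%:E)%E -> P k S']) ->
  exists E, [/\ measurable E, (mu E < +oo)%E & forall k, P k E].
Proof.
move=> CS0 mC dense.
(* A state is an index with a set and a tolerance; outside the domain a dummy value makes the choice
   function total. *)
have next (x : nat * (set T * R)) : exists y : set T * R,
    C x.2.1 -> 0 < x.2.2 -> [/\ C y.1, (mu (setY x.2.1 y.1) < x.2.2%:E)%E, 0 < y.2 &
      forall S', measurable S' -> (mu S' < +oo)%E ->
        (mu (setY y.1 S') <= y.2%:E)%E -> P x.1 S'].
  have [[Cx x0]|nx] := pselect (C x.2.1 /\ 0 < x.2.2).
    by have [S [r h]] := dense x.1 _ _ Cx x0; exists (S, r).
  by exists (S0, 0) => Cx x0; case: nx.
have [f fP] := choice next.
(* Step k moves the set by less than [e k], and [e k.+1] is at most half of both [e k] and the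
   stability radius [r k]. All moves from k + 1 on thus add up to at most 2 [e k.+1] <= [r k]. *)
pose z := fix z k : set T * R := if k is k'.+1 then
  let y := f (k', z k') in (y.1, Num.min (z k').2 y.2 / 2) else (S0, 1).
pose F k := (z k).1; pose e k := (z k).2; pose r k := (f (k, z k)).2.
have eS k : e k.+1 = Num.min (e k) (r k) / 2 by [].
have zP k : C (F k) /\ 0 < e k.
  elim: k => [|k [Ck ek]]; first by split.
  have [Cy _ y0 _] := fP (k, z k) Ck ek.
  by split => //; rewrite eS divr_gt0// lt_min ek.
have FP k S' : measurable S' -> (mu S' < +oo)%E ->
    (mu (setY (F k.+1) S') <= (r k)%:E)%E -> P k S'.
  by have [Ck ek] := zP k; have [_ _ _] := fP (k, z k) Ck ek; exact.
have muY k : (mu (setY (F k) (F k.+1)) < (e k)%:E)%E.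
  by have [Ck ek] := zP k; have [] := fP (k, z k) Ck ek.
have mF k : measurable (F k) by have [/mC[]] := zP k.
have mY (A B : set T) : measurable A -> measurable B -> measurable (setY A B).
  by move=> mA mB; apply: measurableU; exact: measurableD.
have e_r k : e k.+1 *+ 2 <= r k.
  by rewrite eS mulr2n -splitr ge_min lexx orbT.
have e_half k : e k.+1 <= e k / 2.
  by rewrite eS ler_wpM2r// ge_min lexx.
(* Written in the form of the terms of [epsilon_trick0], whose series is bounded by the
   numerator. *)
have e_geo m j : e (m + j)%N <= e m *+ 2 / (2 ^ j.+1)%:R.
  elim: j => [|j ih]; first by rewrite addn0 expn1 mulr2n mulrDl -splitr.
  rewrite addnS; apply: le_trans (e_half _) _.
  rewrite (expnS 2 j.+1) natrM invfM mulrCA mulrC ler_wpM2l//.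
pose E := \bigcup_N \bigcap_(j in [set j | N <= j]%N) F j.
have mE : measurable E.
  by apply: bigcup_measurable => N _; apply: bigcap_measurableType.
have tail m : (mu (setY (F m) E) <= (e m *+ 2)%:E)%E.
  have em0 : 0 <= e m *+ 2 by rewrite mulrn_wge0// ltW//; case: (zP m).
  apply: le_trans (epsilon_trick0 xpredT em0).
  apply: (@le_trans _ _ (\sum_(0 <= j <oo) mu (setY (F (m + j)%N) (F (m + j).+1)))%E).
    apply: measure_sigma_subadditive; [by move=> j; exact: mY|exact: mY|].
    exact: setY_bigcup_liminf.
  apply: lee_nneseries => [j _ _|j _]; first exact: measure_ge0.
  by apply: le_trans (ltW (muY _)) _; rewrite lee_fin.
have Ey : (mu E < +oo)%E.
  apply: (@le_lt_trans _ _ (mu (F 0%N `|` setY (F 0%N) E))).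
    apply: le_measure; rewrite ?inE//; first by apply: measurableU => //; exact: mY.
    move=> x Ex; have [F0|F0] := pselect (F 0%N x); first by left.
    by right; right.
  apply: le_lt_trans (measureU2 _ _ _) _ => //; first exact: mY.
  apply: lte_add_pinfty; first by have [_] := mC _ CS0.
  by apply: le_lt_trans (tail 0%N) _; rewrite ltry.
exists E; split => // k; apply: FP => //.
by apply: le_trans (tail _) _; rewrite lee_fin.
Qed.

End stable_dense.

Theorem theorem2p1 (R : realType) (n : nat) (n_gt0 : (0 < n)%N) :
  exists E : set 'rV[R]_n,
    [/\ measurable E,
        perimeter E = +oo%E &
        limf_einf (fun eps : R =>
          (`|ln eps|^-1)%:E *
          Hhalf_norm2 (fun x =>
            (convolution (gauss_eps eps) (\1_E : 'rV[R]_n -> R) x)%:C%C))%E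
          0^'+ = 0%E].
Proof.
pose mu := @lebesgue_rV R n.
pose i0 := Ordinal n_gt0.
pose low k (S : set 'rV[R]_n) := exists eps : R, 0 < eps < k.+1%:R^-1 /\
  ((`|ln eps|^-1)%:E * gauss_energy eps S <= (k.+1%:R^-1)%:E)%E.
(* The two families are interleaved: even indices ask for perimeter, odd ones for small energy. *)
pose P k (S : set 'rV[R]_n) :=
  if odd k then low k./2 S else ((k./2%:R : R)%:E <= perimeter S)%E.
have [E [mE Ey PE]] : exists E, [/\ measurable E, (mu E < +oo)%E & forall k, P k E].
  apply: (@stable_dense_inhabited _ _ _ mu [set S | open S /\ (mu S < +oo)%E] P set0).
  - by split; [exact: open0|rewrite measure0].
  - by move=> S [/open_rV_measurable].
  move=> k E eta [oE Ey] eta0; have [ok|ok] := boolP (odd k).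
    have [S [r [eps [CS YS r0 eps0 h]]]] := low_energy_dense i0 k./2 oE Ey eta0.
    by exists S, r; split => // S' mS' S'y YS'; rewrite /P ok; exists eps; split => //; exact: h.
  have [S [r [CS YS r0 h]]] := perimeter_dense i0 k./2 oE Ey eta0.
  by exists S, r; split => // S' mS' S'y YS'; rewrite /P (negbTE ok); exact: h.
exists E; split => //.
  apply/eqyP => A A0; apply: (@le_trans _ _ ((Num.truncn A).+1%:R : R)%:E).
    by rewrite lee_fin ltW// truncnS_gt.
  by have := PE ((Num.truncn A).+1).*2; rewrite /P odd_double doubleK.
rewrite limf_einfE; set f := fun eps : R => _.
have f0 eps : (0 <= f eps)%E.
  by apply: mule_ge0; [rewrite lee_fin invr_ge0|exact: Hhalf_norm2_ge0].
apply/eqP; rewrite eq_le; apply/andP; split.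
  apply: ge_ereal_sup => _ [V V0 <-].
  have /nbhs_ballP[d /= d0 dV] := V0.
  apply/lee_addgt0Pr => e e0; rewrite add0e.
  (* 1/(k+1) <= d puts the scale found inside the given neighbourhood, and 1/(k+1) <= e bounds the
     value there. *)
  pose k := Num.truncn (Num.min d e)^-1.
  have de0 : 0 < Num.min d e by rewrite lt_min d0.
  have kde : k.+1%:R^-1 <= Num.min d e.
    by rewrite invf_ple ?posrE// ltW// truncnS_gt.
  have [eps [/andP[eps0 epsk] h]] : low k E.
    by have := PE k.*2.+1; rewrite /P/= odd_double/= uphalf_double.
  move: kde; rewrite le_min => /andP[kd ke].
  apply: (@le_trans _ _ (f eps)).
    apply: ereal_inf_lbound; exists eps => //; apply: dV => //=.
    by rewrite /ball/= sub0r normrN gtr0_norm// (lt_le_trans epsk).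
  apply: (@le_trans _ _ ((`|ln eps|^-1)%:E * gauss_energy eps E)%E).
    apply: lee_wpmul2l; first by rewrite lee_fin invr_ge0.
    exact: Hhalf_norm2_le.
  by apply: le_trans h _; rewrite lee_fin.
(* The lower limit is a supremum of infima, and the infimum over the whole line is already
   nonnegative. *)
apply: (@le_trans _ _ (ereal_inf (f @` setT))).
  by apply/ereal_infP => _ [eps _ <-].
by apply: ereal_sup_ubound; exists setT => //; exact: filterT.
Qed.
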